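(* Let $p\geq 3$ be a prime, let $\phi(x)=\frac{ax+b}{cx+d}$ with $a,b,c,d\in\mathbb{Q}_p$, $ad-bc\ne0$, let $\Delta=(d-a)^2+4bc$ and assume $\sqrt{\Delta}\notin\mathbb{Q}_p$. Let $K=\mathbb{Q}_p(\sqrt{\Delta})$ and suppose that $\lambda=\frac{a+d+\sqrt{\Delta}}{a+d-\sqrt{\Delta}}\in K$ is not a root of unity. Suppose that $K$ is a ramified quadratic extension of $\mathbb{Q}_p$, and let $\pi$ be a uniformizer of $K$. Then $|a+d|_p\neq|\sqrt{\Delta}|_p$, and: (1) If $|a+d|_p>|\sqrt{\Delta}|_p$, then $\lambda\equiv 1 \pmod{\pi}$, and the dynamics $(\mathbb{P}^1(\mathbb{Q}_p),\phi)$ is decomposed into $2p^{(v_\pi(\lambda^p-1)-3)/2}$ minimal subsystems, such that each minimal subsystem is topologically conjugate to the adding machine on the odometer $\mathbb{Z}_{(p_s)}$ with $(p_s)=(1,p,p^2,\cdots)$. (2) If $|a+d|_p<|\sqrt{\Delta}|_p$, then $\lambda\equiv -1\pmod{\pi}$, and the dynamics $(\mathbb{P}^1(\mathbb{Q}_p),\phi)$ is decomposed into $p^{(v_\pi(\lambda^p+1)-3)/2}$ minimal subsystems, such that each minimal subsystem is topologically conjugate to the adding machine on the odometer $\mathbb{Z}_{(p_s)}$ with $(p_s)=(2,2p,2p^2,\cdots)$.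
   Context: $\mathbb{P}^1(\mathbb{Q}_p)=\mathbb{Q}_p\cup\{\infty\}$ with its usual compact topology. $|\cdot|_p$ and $v_p=-\log_p|\cdot|_p$ are extended to $K$; $v_\pi:=e\,v_p$ where $e$ is the ramification index of $K/\mathbb{Q}_p$ (here $e=2$, so $v_\pi(\pi)=1$). A subsystem is a pair $(E,\phi)$ with $E$ compact and $\phi(E)\subset E$; it is minimal if $E=\overline{\{\phi^n(x):n\ge 0\}}$ for every $x\in E$. ''Decomposed into $M$ minimal subsystems'' means that $\mathbb{P}^1(\mathbb{Q}_p)$ is the disjoint union of $M$ nonempty compact $\phi$-invariant sets, on each of which $\phi$ is minimal. For positive integers $p_s\mid p_{s+1}$ $(s\ge1)$, the odometer $\mathbb{Z}_{(p_s)}$ is the inverse limit of $\mathbb{Z}/p_s\mathbb{Z}$, and the adding machine is $x\mapsto x+1$ on it. *)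

(* Defs.v *)
From HB Require Import structures.
From mathcomp Require Import all_boot all_order all_algebra all_field cyclic.
From mathcomp Require Import all_classical all_reals topology exp.

Set Implicit Arguments.
Unset Strict Implicit.
Unset Printing Implicit Defensive.

Import Order.TTheory GRing.Theory Num.Theory.

Local Open Scope classical_set_scope.
Local Open Scope ring_scope.

(* The inverse limit of the Z/(q s), for q s > 0 and q s %| q s.+1: a residue
   class modulo q s is represented by its remainder in {0, ..., q s - 1}. *)
Definition inverse_limit (q : nat -> nat) : set {ptws nat -> nat} :=
  [set x | forall s, (x s < q s)%N /\ (x s.+1 %% q s = x s)%N].

Definition adding_machine (q : nat -> nat) (x : {ptws nat -> nat}) :
  {ptws nat -> nat} := fun s => ((x s).+1 %% q s)%N.

(* The ring Z_p.  The proof of primality is a parameter of the type so that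
   it can carry the structure of an integral domain. *)
Definition padic_int (p : nat) (p_pr : prime p) :=
  set_type (inverse_limit (expn p)).

Section PadicInt.
Context (p : nat) (p_pr : prime p).
Local Notation Zp := (padic_int p_pr).
Implicit Types x y z u v : Zp.

HB.instance Definition _ := Choice.on Zp.

Definition padic_res x (s : nat) : nat := (set_val x : nat -> nat) s.

Let q_gt0 s : (0 < p ^ s)%N. Proof. by rewrite expn_gt0 prime_gt0. Qed.

Lemma padic_res_lt x s : (padic_res x s < p ^ s)%N.
Proof. by have [] := set_mem (valP x) s. Qed.

Lemma padic_resS x s : (padic_res x s.+1 %% p ^ s)%N = padic_res x s.
Proof. by have [] := set_mem (valP x) s. Qed.

Lemma padic_res_mod x s : (padic_res x s %% p ^ s)%N = padic_res x s.
Proof. by rewrite modn_small// padic_res_lt. Qed.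

Lemma padic_resD x m s : (padic_res x (m + s) %% p ^ s)%N = padic_res x s.
Proof.
elim: m => [|m IHm]; first exact: padic_res_mod.
by rewrite -[RHS]IHm -(padic_resS x (m + s)) modn_dvdm// dvdn_exp2l// leq_addl.
Qed.

Lemma padic_intP x y : (forall s, padic_res x s = padic_res y s) <-> x = y.
Proof. by split=> [xy|->//]; apply/val_inj/funext. Qed.

Definition padic_of (f : nat -> nat)
    (fP : forall s, (f s.+1 = f s %[mod p ^ s])%N) : Zp.
Proof.
exists (fun s => f s %% p ^ s)%N; apply/mem_set => s; split.
  by rewrite ltn_mod.
by rewrite modn_dvdm ?dvdn_exp2l// fP.
Defined.

Lemma padic_ofE f fP s : padic_res (@padic_of f fP) s = (f s %% p ^ s)%N.
Proof. by []. Qed.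

Fact padic_nat_proof n s : (n = n %[mod p ^ s])%N. Proof. by []. Qed.
Definition padic_nat n : Zp := padic_of (padic_nat_proof n).

Fact padic_opp_proof x s :
  (p ^ s.+1 - padic_res x s.+1 = p ^ s - padic_res x s %[mod p ^ s])%N.
Proof.
apply/eqP; rewrite -(eqn_modDr (padic_res x s)).
rewrite subnK; last by rewrite ltnW// padic_res_lt.
rewrite -[X in (_ - _ + X)%N]padic_resS modnDmr.
rewrite subnK; last by rewrite ltnW// padic_res_lt.
by rewrite modnn expnS modnMl.
Qed.
Definition padic_opp x : Zp := padic_of (padic_opp_proof x).

Fact padic_add_proof x y s : (padic_res x s.+1 + padic_res y s.+1
  = padic_res x s + padic_res y s %[mod p ^ s])%N.
Proof. by rewrite -modnDm !padic_resS. Qed.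
Definition padic_add x y : Zp := padic_of (padic_add_proof x y).

Fact padic_mul_proof x y s : (padic_res x s.+1 * padic_res y s.+1
  = padic_res x s * padic_res y s %[mod p ^ s])%N.
Proof. by rewrite -modnMm !padic_resS. Qed.
Definition padic_mul x y : Zp := padic_of (padic_mul_proof x y).

Fact padic_addA : associative padic_add.
Proof.
by move=> x y z; apply/padic_intP => s; rewrite !padic_ofE modnDml modnDmr addnA.
Qed.

Fact padic_addC : commutative padic_add.
Proof. by move=> x y; apply/padic_intP => s; rewrite !padic_ofE addnC. Qed.

Fact padic_add0 : left_id (padic_nat 0) padic_add.
Proof.
by move=> x; apply/padic_intP => s; rewrite !padic_ofE mod0n padic_res_mod.
Qed.

Fact padic_addN : left_inverse (padic_nat 0) padic_opp padic_add.
Proof.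
move=> x; apply/padic_intP => s.
by rewrite !padic_ofE modnDml subnK ?modnn ?mod0n// ltnW// padic_res_lt.
Qed.

HB.instance Definition _ :=
  GRing.isZmodule.Build Zp padic_addA padic_addC padic_add0 padic_addN.

Fact padic_mulA : associative padic_mul.
Proof.
by move=> x y z; apply/padic_intP => s; rewrite !padic_ofE modnMml modnMmr mulnA.
Qed.

Fact padic_mulC : commutative padic_mul.
Proof. by move=> x y; apply/padic_intP => s; rewrite !padic_ofE mulnC. Qed.

Fact padic_mul1 : left_id (padic_nat 1) padic_mul.
Proof.
by move=> x; apply/padic_intP => s; rewrite !padic_ofE modnMml mul1n padic_res_mod.
Qed.

Fact padic_mulDl : left_distributive padic_mul padic_add.
Proof.
move=> x y z; apply/padic_intP => s.
by rewrite !padic_ofE modnMml modnDm mulnDl.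
Qed.

Fact padic_oner_neq0 : padic_nat 1 != padic_nat 0.
Proof.
apply/eqP => /padic_intP /(_ 1%N).
by rewrite !padic_ofE expn1 mod0n modn_small ?prime_gt1.
Qed.

HB.instance Definition _ := GRing.Zmodule_isComNzRing.Build Zp
  padic_mulA padic_mulC padic_mul1 padic_mulDl padic_oner_neq0.

Definition padic_unit : {pred Zp} := fun x => `[< exists y, y * x = 1 >].
Definition padic_inv x : Zp :=
  if padic_unit x then xget 0 [set y | y * x = 1] else x.

Fact padic_mulVx : {in padic_unit, left_inverse 1 padic_inv *%R}.
Proof.
move=> x xU; rewrite /padic_inv ifT//; move/asboolP: xU => [y yx].
by have := xgetPex 0 (ex_intro [set y | y * x = 1] y yx).
Qed.

Fact padic_unitPl x y : y * x = 1 -> padic_unit x.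
Proof. by move=> yx; apply/asboolP; exists y. Qed.

Fact padic_invr_out : {in [predC padic_unit], padic_inv =1 id}.
Proof. by move=> x; rewrite inE => xU; rewrite /padic_inv ifN. Qed.

HB.instance Definition _ := GRing.ComNzRing_hasMulInverse.Build Zp
  padic_mulVx padic_unitPl padic_invr_out.

Lemma padic_res0 s : padic_res 0 s = 0%N.
Proof. by rewrite padic_ofE mod0n. Qed.

Lemma padic_res_natr n s : padic_res n%:R s = (n %% p ^ s)%N.
Proof.
elim: n => [|n IHn]; first by rewrite padic_res0 mod0n.
by rewrite -addn1 natrD padic_ofE IHn padic_ofE modnDm.
Qed.

Lemma padic_resM x y s :
  padic_res (x * y) s = (padic_res x s * padic_res y s %% p ^ s)%N.
Proof. by []. Qed.

Lemma padic_res1_mod x s : (padic_res x s.+1 %% p)%N = padic_res x 1.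
Proof. by have := padic_resD x s 1; rewrite addn1 expn1. Qed.

Lemma padic_unitE x : (x \is a GRing.unit) = (padic_res x 1 != 0%N).
Proof.
apply/idP/idP => [xU|x1].
  apply/eqP => x1; have := mulrV xU => /padic_intP/(_ 1%N).
  by rewrite padic_resM x1 mod0n (padic_res_natr 1) expn1 modn_small// prime_gt1.
have cop s : coprime (padic_res x s) (p ^ s).
  case: s => [|s]; first by rewrite expn0 coprimen1.
  rewrite coprimeXr// coprime_sym prime_coprime//.
  by rewrite /dvdn padic_res1_mod.
pose f s := (padic_res x s ^ (totient (p ^ s)).-1)%N.
have fx s : (f s * padic_res x s = 1 %[mod p ^ s])%N.
  by rewrite -expnSr prednK ?totient_gt0// Euler_exp_totient.
have fP s : (f s.+1 = f s %[mod p ^ s])%N.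
  have fx1 : (f s.+1 * padic_res x s = 1 %[mod p ^ s])%N.
    rewrite -padic_resS modnMmr.
    have := congr1 (modn ^~ (p ^ s)%N) (fx s.+1).
    by rewrite !modn_dvdm ?dvdn_exp2l.
  rewrite -[in LHS](muln1 (f s.+1)) -modnMmr -(fx s) modnMmr mulnCA.
  by rewrite -modnMmr fx1 modnMmr muln1.
apply/unitrPr; exists (padic_of fP); apply/padic_intP => s.
by rewrite padic_resM padic_ofE modnMmr mulnC fx padic_ofE.
Qed.


Lemma padic_natr_p : (p%:R : Zp) \isn't a GRing.unit.
Proof. by rewrite padic_unitE padic_res_natr expn1 modnn. Qed.

Lemma padic_expp_neq0 n : p%:R ^+ n != 0 :> Zp.
Proof.
apply/eqP => /padic_intP/(_ n.+1); rewrite -natrX padic_res_natr padic_res0.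
rewrite modn_small ?ltn_exp2l ?prime_gt1//; by move: (q_gt0 n); case: expn.
Qed.

Lemma padic_int_factor x :
  x != 0 -> exists n, exists2 u, u \is a GRing.unit & x = p%:R ^+ n * u.
Proof.
move=> x0; have [|n xn] := @ex_minnP (fun s => padic_res x s != 0%N).
  apply: contrapT => /forallNP nx; move/eqP: x0; apply; apply/padic_intP => s.
  by rewrite padic_res0; apply/eqP/negPn/negP/nx.
case: n xn => [|m] xm min_m; first by have := padic_res_lt x 0; case: padic_res xm.
have xm0 : padic_res x m = 0%N.
  by apply/eqP/negPn/negP => /min_m; rewrite ltnn.
have dvd s : (p ^ m %| padic_res x (s + m))%N by rewrite /dvdn padic_resD xm0.
have fP s : (padic_res x (s.+1 + m) %/ p ^ m
    = padic_res x (s + m) %/ p ^ m %[mod p ^ s])%N.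
  by rewrite !modn_divl -!expnD addSn padic_resS padic_res_mod.
exists m, (padic_of fP).
  rewrite padic_unitE padic_ofE modn_divl -expnD padic_res_mod add1n.
  have := dvd 1%N; rewrite add1n => /divnK xE.
  by apply: contra_neq xm => x0'; rewrite -xE x0'.
apply/padic_intP => s; rewrite -natrX padic_resM padic_ofE padic_res_natr.
by rewrite modnMml modnMmr mulnC divnK// addnC padic_resD.
Qed.

Fact padic_integral : GRing.integral_domain_axiom Zp.
Proof.
move=> x y xy0; apply/norP => -[x0 y0]; move/eqP: xy0; apply/negP.
have [m [u uU ->]] := padic_int_factor x0.
have [n [v vU ->]] := padic_int_factor y0.
rewrite mulrACA -exprD; apply/eqP => /(congr1 (fun z => z * (u * v)^-1)).
rewrite mul0r mulrK ?unitrM ?uU//; exact/eqP/padic_expp_neq0.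
Qed.

HB.instance Definition _ :=
  GRing.ComUnitRing_isIntegral.Build Zp padic_integral.

End PadicInt.

Definition padic (p : nat) (p_pr : prime p) := {fraction padic_int p_pr}.

Section Padic.
Context (p : nat) (p_pr : prime p).
Local Notation Zp := (padic_int p_pr).
Local Notation Qp := (padic p_pr).
Local Notation "x %:F" := (@FracField.tofrac _ x).
Implicit Types x y z : Qp.

HB.instance Definition _ := GRing.Field.on Qp.

Definition padic_val x : int :=
  xget 0 [set n : int | exists2 u : Zp, u \is a GRing.unit
                                      & x = p%:R ^ n * u%:F].

Definition padic_abs {R : realFieldType} x : R :=
  if x == 0 then 0 else p%:R ^ (- padic_val x).

Lemma padic_p_neq0 : p%:R != 0 :> Qp.
Proof.
have := padic_expp_neq0 p_pr 1; rewrite expr1 -tofrac_eq0.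
by rewrite rmorph_nat.
Qed.

Lemma padic_frac x : exists a b : Zp, b != 0 /\ x = a%:F / b%:F.
Proof.
elim/quotW: x => r; exists \n_r, \d_r; split; first exact: denom_ratioP.
apply: (canRL (mulfK _)); first by rewrite tofrac_eq0 denom_ratioP.
unlock FracField.tofrac; rewrite -[LHS]FracField.pi_mul.
apply/eqmodP; rewrite /= FracField.equivfE /FracField.mulf.
by rewrite !numden_Ratio ?mulf_neq0 ?denom_ratioP ?oner_eq0// !mulr1 mulrC.
Qed.

Lemma padic_factor x : x != 0 ->
  exists n : int, exists2 u : Zp, u \is a GRing.unit & x = p%:R ^ n * u%:F.
Proof.
have [a [b [b0 ->]]] := padic_frac x => ab0.
have a0 : a != 0 by apply: contra_neq ab0 => ->; rewrite rmorph0 mul0r.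
have [m [u uU ->]] := padic_int_factor a0.
have [n [v vU ->]] := padic_int_factor b0.
exists (m%:Z - n%:Z), (u / v); first by rewrite unitrM uU unitrV.
have -> : (u / v)%:F = u%:F / v%:F.
  apply: (canRL (mulfK _)); first by rewrite tofrac_eq0 (memPn _ _ vU)// unitr0.
  by rewrite -rmorphM divrK.
rewrite !rmorphM !rmorphXn/= !rmorph_nat invfM mulrACA; congr (_ * _).
by rewrite expfzDr ?padic_p_neq0// -invr_expz.
Qed.

Lemma padic_tofrac_neq0 (u : Zp) : u \is a GRing.unit -> u%:F != 0.
Proof. by rewrite tofrac_eq0; apply: contraL => /eqP ->; rewrite unitr0. Qed.

Lemma padic_val_unique (m n : int) (u v : Zp) :
  u \is a GRing.unit -> v \is a GRing.unit ->
  (p%:R : Qp) ^ m * u%:F = p%:R ^ n * v%:F -> m = n.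
Proof.
wlog nm : m n u v / n <= m => [IH uU vU|uU vU uv].
  by case: (leP n m) => [|/ltW] nm => [|/esym] /IH ->.
have [k mE] : exists k : nat, m = n + k%:Z.
  by exists `|m - n|%N; rewrite gez0_abs ?subr_ge0// addrCA subrr addr0.
move: uv; rewrite mE expfzDr ?padic_p_neq0// -mulrA.
move/mulfI => /(_ (expfz_neq0 _ padic_p_neq0)); rewrite -exprnP.
have -> : (p%:R : Qp) = (p%:R : Zp)%:F by rewrite rmorph_nat.
rewrite -rmorphXn -rmorphM => /eqP; rewrite tofrac_eq => /eqP kuv.
case: k kuv {mE} => [|k] kuv; first by rewrite addr0.
by move: vU; rewrite -kuv unitrM exprS unitrM (negbTE (padic_natr_p _)).
Qed.

Lemma padic_valE (n : int) (u : Zp) :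
  u \is a GRing.unit -> padic_val (p%:R ^ n * u%:F) = n.
Proof.
move=> uU; rewrite /padic_val; case: xgetP => [m _ [v vU]|].
  by move/(padic_val_unique uU vU).
by move/(_ n)/forall2NP/(_ u) => [].
Qed.

Section Abs.
Context {R : realFieldType}.
Local Notation abs x := (padic_abs x : R).

Let p_gt1 : 1 < p%:R :> R. Proof. by rewrite ltr1n prime_gt1. Qed.
Let p_gt0 : 0 < p%:R :> R. Proof. by rewrite ltr0n prime_gt0. Qed.

Lemma padic_abs0 : abs 0 = 0. Proof. by rewrite /padic_abs eqxx. Qed.

Lemma padic_absE (n : int) (u : Zp) :
  u \is a GRing.unit -> abs (p%:R ^ n * u%:F) = p%:R ^ (- n).
Proof.
move=> uU; rewrite /padic_abs padic_valE// ifN// mulf_neq0//.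
  by rewrite expfz_neq0// padic_p_neq0.
exact: padic_tofrac_neq0.
Qed.

Lemma padic_abs_gt0 x : (0 < abs x) = (x != 0).
Proof.
rewrite /padic_abs; case: eqP => _; first by rewrite ltxx.
by rewrite exprz_gt0.
Qed.

Lemma padic_abs_ge0 x : 0 <= abs x.
Proof. by rewrite /padic_abs; case: ifP => // _; rewrite exprz_ge0// ltW. Qed.

Lemma padic_absM x y : abs (x * y) = abs x * abs y.
Proof.
have [->|x0] := eqVneq x 0; first by rewrite mul0r padic_abs0 mul0r.
have [->|y0] := eqVneq y 0; first by rewrite mulr0 padic_abs0 mulr0.
have [m [u uU ->]] := padic_factor x0; have [n [v vU ->]] := padic_factor y0.
rewrite mulrACA -expfzDr ?padic_p_neq0// -rmorphM.
by rewrite !padic_absE ?unitrM ?uU// opprD expfzDr ?lt0r_neq0.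
Qed.

Lemma padic_absN x : abs (- x) = abs x.
Proof.
have [->|x0] := eqVneq x 0; first by rewrite oppr0.
have [m [u uU ->]] := padic_factor x0.
by rewrite -mulrN -rmorphN !padic_absE ?unitrN.
Qed.

Let padic_abs_le (m : int) (w : Zp) : abs (p%:R ^ m * w%:F) <= p%:R ^ (- m).
Proof.
have [->|/padic_int_factor[n [u uU ->]]] := eqVneq w 0.
  by rewrite rmorph0 mulr0 padic_abs0 exprz_ge0// ltW.
rewrite rmorphM rmorphXn rmorph_nat mulrA exprnP -expfzDr ?padic_p_neq0//.
by rewrite padic_absE// ler_eXz2l// lerN2 lerDl.
Qed.

Lemma padic_absD x y (e : R) :
  abs x <= e -> abs y <= e -> abs (x + y) <= e.
Proof.
have [->|x0] := eqVneq x 0; first by rewrite add0r.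
have [->|y0] := eqVneq y 0; first by rewrite addr0.
have [m [u uU ->]] := padic_factor x0; have [n [v vU ->]] := padic_factor y0.
rewrite !padic_absE//.
wlog mn : m n u v uU vU / m <= n => [IH me ne|me _].
  by case: (leP m n) => [|/ltW] mn; last rewrite addrC; exact: IH.
apply: le_trans me.
have [k ->] : exists k : nat, n = m + k%:Z.
  by exists `|n - m|%N; rewrite gez0_abs ?subr_ge0// addrCA subrr addr0.
rewrite expfzDr ?padic_p_neq0// -mulrA -mulrDr -exprnP.
have -> : (p%:R : Qp) = (p%:R : Zp)%:F by rewrite rmorph_nat.
by rewrite -rmorphXn -rmorphM -rmorphD rmorph_nat padic_abs_le.
Qed.

End Abs.

(* The p-adic absolute value has rational values on Q_p, so the metric on Q_p
   is taken over rat, independently of any choice of realType. *)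
Definition padic_ball x (e : rat) y : Prop := padic_abs (x - y) < e.

Fact padic_ball_center x (e : rat) : 0 < e -> padic_ball x e x.
Proof. by rewrite /padic_ball subrr padic_abs0. Qed.

Fact padic_ball_sym x y (e : rat) : padic_ball x e y -> padic_ball y e x.
Proof. by rewrite /padic_ball -opprB padic_absN. Qed.

Fact padic_ball_triangle x y z (e1 e2 : rat) :
  padic_ball x e1 y -> padic_ball y e2 z -> padic_ball x (e1 + e2) z.
Proof.
rewrite /padic_ball => xy yz; have -> : x - z = (x - y) + (y - z).
  by rewrite addrA subrK.
have xy0 := padic_abs_ge0 (R := rat) (x - y).
have yz0 := padic_abs_ge0 (R := rat) (y - z).
apply: le_lt_trans (ltrD xy yz).
by apply: padic_absD; rewrite ?lerDl ?lerDr.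
Qed.

Definition padic_ent : set_system (Qp * Qp) := entourage_ padic_ball.

HB.instance Definition _ := isPointed.Build Qp 0.
HB.instance Definition _ := hasNbhs.Build Qp (nbhs_ padic_ent).
HB.instance Definition _ := @Nbhs_isPseudoMetric.Build rat Qp
  padic_ent erefl padic_ball padic_ball_center padic_ball_sym
  padic_ball_triangle erefl.

End Padic.

(* P^1(Q_p) = Q_p U {oo}, with oo = None.  As Q_p is locally compact and
   Hausdorff, the one-point compactification has the usual topology. *)
Definition padic_P1 (p : nat) (p_pr : prime p) : topologicalType :=
  one_point_compactification (padic p_pr).

Definition mobius (p : nat) (p_pr : prime p) (a b c d : padic p_pr)
    (x : padic_P1 p_pr) : padic_P1 p_pr :=
  match x with
  | Some x => if c * x + d == 0 then None else Some ((a * x + b) / (c * x + d))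
  | None => if c == 0 then None else Some (a / c)
  end.

Section Dynamics.
Context {T U : topologicalType}.

Definition minimal_subsystem (phi : T -> T) (E : set T) :=
  [/\ E !=set0, compact E, phi @` E `<=` E &
      forall x, E x -> E = closure [set iter n phi x | n in [set: nat]]].

Definition minimal_decomposition (phi : T -> T) (M : nat) (E : 'I_M -> set T) :=
  [/\ forall i, minimal_subsystem phi (E i),
      trivIset [set: 'I_M] E & \bigcup_i E i = [set: T]].

Definition topologically_conjugate (A : set T) (f : T -> T)
    (B : set U) (g : U -> U) :=
  exists (h : T -> U) (k : U -> T),
    [/\ {homo h : x / A x >-> B x} /\ {homo k : y / B y >-> A y},
        forall x, A x -> k (h x) = x,
        forall y, B y -> h (k y) = y,
        {within A, continuous h} /\ {within B, continuous k} &
        forall x, A x -> h (f x) = g (h x)].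

End Dynamics.

Definition conjugate_to_adding_machine {T : topologicalType}
    (phi : T -> T) (E : set T) (q : nat -> nat) :=
  topologically_conjugate E phi (inverse_limit q) (adding_machine q).

Section Extension.
Context (R : realType) (p : nat) (p_pr : prime p).
Context (K : fieldExtType (padic p_pr)) (absK : K -> R).
Implicit Types x y z pi : K.

Record extends_padic_abs : Prop := {
  extends_padic_abs_ge0 : forall x, 0 <= absK x;
  extends_padic_abs_eq0 : forall x, absK x = 0 -> x = 0;
  extends_padic_absM : forall x y, absK (x * y) = absK x * absK y;
  extends_padic_absD :
    forall x y, absK (x + y) <= Num.max (absK x) (absK y);
  extends_padic_abs_base : forall a : padic p_pr, absK a%:A = padic_abs a
}.

(* v_p = - log_p |.|_p; the value at 0 is junk. *)
Definition vp x : R := - (ln (absK x) / ln p%:R).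

(* v_p (K^* ) = (1/e) Z *)
Definition ramification_index (e : nat) : Prop :=
  (0 < e)%N /\
  [set vp x | x in [set x | x != 0]] =
  [set k%:~R / e%:R | k in [set: int]].

Definition v_unif (e : nat) x : R := e%:R * vp x.

Definition integral_elt x : Prop := absK x <= 1.

(* A generator of the maximal ideal {x | |x| < 1} of the valuation ring. *)
Definition uniformizer pi : Prop :=
  forall x, absK x < 1 <-> exists2 y, integral_elt y & x = pi * y.

Definition eq_mod pi x y : Prop :=
  exists2 z, integral_elt z & x - y = pi * z.

End Extension.

(* Main.v *)
Require Import Defs.
From HB Require Import structures.
From mathcomp Require Import all_boot all_order all_algebra all_field.
From mathcomp Require Import all_classical all_reals topology exp.
From mathcomp Require Import ring zify.

Set Implicit Arguments.
Unset Strict Implicit.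
Unset Printing Implicit Defensive.

Import Order.TTheory GRing.Theory Num.Theory.

Local Open Scope classical_set_scope.
Local Open Scope ring_scope.

(* As K is ramified, Delta = r^2 D with D / p a unit.  Put s = sqrt D.  An
   affine change of coordinate identifies P^1(Q_p) with P(K) = K^* / Q_p^* and
   phi with multiplication by t + r s, where t = a + d.  Every class of P(K)
   contains exactly one element of the form 1 + y s or s (1 + y s) with y in
   Z_p.  If |t| > |r s|, multiplication by t + r s is multiplication by
   1 + B s with B = r / t in Z_p, which preserves the two forms; if
   |t| < |r s|, it is multiplication by s (1 + B s) with B = t / (r D) in Z_p,
   which exchanges them.  Write (1 + B s)^n = A_n + B_n s, and let m be the
   valuation of B_p.  Then y is fixed modulo p^(m + j) by the n-th iterate iff
   p^(m + j) | B_n, which holds iff p^(j + 1) | n.  Hence all orbits modulo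
   p^(m + j) have the same length, the orbits modulo p^m give the minimal
   components, and lambda^p -+ 1 has valuation 2 m + 1 at pi. *)

(** * Odometers from towers of periodic partitions *)

(** The parameter is the valuation of [B_p], not that of [B], because the first factor p in the
    exponent may gain more than one factor p. For instance [B_3 = 3 B + D B^3], and for [D = 3 u]
    the factor [1 + u B^2] may be divisible by 3. Once the coordinate on [s] is divisible by p, each
    further factor p in the exponent gains exactly one. This is why lambda^p, and not lambda, enters
    the count, and why the partitions start modulo p^m: there the 2 p^m classes lie on cycles of
    length p, or 2 p if the two forms are exchanged. The number m exists because lambda is not a
    root of unity, so that [B_p] is nonzero. Ramification enters through parity: if Delta had even
    valuation, K would be generated by the root of a unit and have the absolute values of Q_p; odd
    valuation keeps |t| and |r s| apart. *)

Lemma fcard_uniform_order (T : finType) (f : T -> T) (n : nat) :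
  (forall x k, (iter k f x == x) = (n %| k)%N) -> (0 < n)%N ->
  injective f /\ (fcard f T * n = #|T|)%N.
Proof.
move=> fn n0.
have nE x : iter n f x = x by apply/eqP; rewrite fn.
have injf : injective f.
  by move=> x y xy; rewrite -(nE x) -(nE y) -(prednK n0) !iterSr xy.
split=> //; apply: (fcard_order_set injf); last by move=> x y _.
apply/fintype.subsetP => x _; rewrite inE eqn_leq.
apply/andP; split; last first.
  by rewrite dvdn_leq ?order_gt0// -(fn x) iter_order.
rewrite leqNgt; apply/negP => lt_n.
(* If [n] were below the order, [iter n f x = x] would have index [n] in the orbit of [x], whereas
   [x] has index 0. *)
have := findex_iter lt_n; rewrite nE.
have := @findex_iter _ f x 0 (order_gt0 f x); rewrite /= => ->.
by move=> n00; rewrite -n00 ltnn in n0.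
Qed.

(** Replaces the extraction of a convergent subsequence, which compactness alone does not give. *)
Lemma compact_seq_cluster (T : topologicalType) (u : nat -> T) :
  compact [set: T] ->
  exists z : T, forall (U : set T) N,
    nbhs z U -> exists2 n, (N <= n)%N & U (u n).
Proof.
move=> /(_ (u @ \oo) _ filterT) [z [_ cz]]; exists z => U N Uz.
have tailN : (u @ \oo) [set u n | n in [set n | (N <= n)%N]].
  by exists N => // n /= Nn; exists n.
by have [_ [[n Nn <-] Un]] := cz _ _ tailN Uz; exists n.
Qed.

Lemma nbhs_ptws_coord (z : {ptws nat -> nat}) s :
  nbhs z [set y : {ptws nat -> nat} | y s = z s].
Proof.
by apply: (@proj_continuous nat (fun=> nat) s z [set n | n = z s]) => /=.
Qed.

Lemma within_continuous_ptws (T : topologicalType) (A : set T)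
    (h : T -> {ptws nat -> nat}) :
  (forall x s, A x -> nbhs x [set y | A y -> h y s = h x s]) ->
  {within A, continuous h}.
Proof.
move=> H; apply/subspace_continuousP => x Ax.
apply/(@pointwise_cvgP nat nat) => s W Ws.
apply: filterS (H x s Ax) => y /= Hy Ay.
suff -> : from_subspace A h y s = h x s by exact: nbhs_singleton Ws.
exact: Hy Ay.
Qed.

Section Odometer.
Context (T : topologicalType) (phi : T -> T).
Context (F : nat -> finType) (l : forall s, T -> F s) (q : nat -> nat).
Hypothesis T_compact : compact [set: T].
Hypothesis l_nbhs : forall s x, nbhs x [set y | l s y = l s x].
Hypothesis l_sep : forall x y, (forall s, l s x = l s y) -> x = y.
Hypothesis lS : forall s x y, l s.+1 x = l s.+1 y -> l s x = l s y.
Hypothesis l_phi : forall s x y, l s x = l s y -> l s (phi x) = l s (phi y).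
(** The index is shifted because level 0 already has period [q 1]; in the application, coarser
    partitions need not have period [q 0]. *)
Hypothesis l_period : forall s x n,
  l s (iter n phi x) = l s x <-> (q s.+1 %| n)%N.
(** Ensures that no component splits when the partition is refined. *)
Hypothesis l_trans : forall s x y, l s x = l s y ->
  exists n, l s.+1 (iter n phi x) = l s.+1 y.
Hypothesis q_gt0 : forall s, (0 < q s)%N.
Hypothesis q_dvdS : forall s, (q s %| q s.+1)%N.

Lemma period_dvd s t : (s <= t)%N -> (q s %| q t)%N.
Proof.
move=> /subnK <-; elim: (t - s)%N => [|n IHn]; first exact: dvdnn.
exact: dvdn_trans IHn (q_dvdS _).
Qed.

Lemma level_le s t x y : (s <= t)%N -> l t x = l t y -> l s x = l s y.
Proof.
move=> /subnK <-; elim: (t - s)%N => [//|n IHn] /lS; exact: IHn.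
Qed.

Lemma level_iter s n x y :
  l s x = l s y -> l s (iter n phi x) = l s (iter n phi y).
Proof. by move=> xy; elim: n => //= n; exact: l_phi. Qed.

Lemma level_iter_dvd s x n : (q s.+1 %| n)%N -> l s (iter n phi x) = l s x.
Proof. by move=> ?; apply/l_period. Qed.

Lemma level_iter_eq s x i j :
  l s (iter i phi x) = l s (iter j phi x) <-> (i = j %[mod q s.+1])%N.
Proof.
wlog ij : i j / (i <= j)%N => [IH|].
  case: (leqP i j) => [|/ltnW] ij; first exact: IH.
  by split=> /esym /IH => /(_ ij) ->.
split.
  rewrite -(subnK ij) iterD => /esym/l_period qij.
  by rewrite -modnDml (eqP qij).
move=> /esym/eqP; rewrite eqn_mod_dvd// => qij; apply: esym.
by rewrite -(subnK ij) iterD; apply/l_period.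
Qed.

(** Otherwise some [u s] agrees with [x] at level [s] but avoids [U]. A cluster point of [u] has all
    labels of [x], hence is [x] by [l_sep], and [u] must enter [U]. *)
Lemma level_nbhs_basis x (U : set T) :
  nbhs x U -> exists s, forall y, l s y = l s x -> U y.
Proof.
move=> Ux; apply: contrapT => /forallNP nU.
have /choice[u uP] s : exists y, l s y = l s x /\ ~ U y.
  by apply: contrapT => /forallNP H; apply: (nU s) => y yx;
    apply: contrapT => nUy; apply: (H y).
have [z zP] := compact_seq_cluster u T_compact.
have zx : z = x.
  apply: l_sep => s; have [n sn /= <-] := zP _ s (l_nbhs s z).
  by apply: level_le sn _; case: (uP n).
rewrite zx in zP; have [n _] := zP _ 0%N Ux.
by case: (uP n).
Qed.

Lemma level_reach s x y :
  l 0%N x = l 0%N y -> exists n, l s (iter n phi x) = l s y.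
Proof.
move=> xy0; elim: s => [|s [n xn]]; first by exists 0%N.
by have [m] := l_trans xn; rewrite -iterD => ?; exists (m + n)%N.
Qed.

(** Level 0 is enough, since [level_reach] lifts a coincidence at level 0 to every level. *)
Definition orbit_level x : set T :=
  [set y | exists n, l 0%N (iter n phi x) = l 0%N y].

Lemma orbit_level_reach s x y : orbit_level x y ->
  exists n, l s (iter n phi x) = l s y.
Proof.
by move=> [n /(level_reach s)[m]]; rewrite -iterD => ?; exists (m + n)%N.
Qed.

Lemma orbit_level_shift x y z :
  orbit_level x y -> orbit_level x z -> orbit_level y z.
Proof.
(* At level 0, [q 1 * i - i] steps forward undo [i] steps, since [q 1] is a period there. *)
move=> [i xi] [j xj]; exists (j + (q 1 * i - i))%N.
rewrite -xj -(level_iter _ xi) -iterD -addnA subnK ?leq_pmull//.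
by rewrite iterD; apply/level_iter/level_iter_dvd/dvdn_mulr.
Qed.

(** The set is closed because labels are locally constant; density of orbits combines
    [orbit_level_reach] with [level_nbhs_basis]. *)
Lemma orbit_level_minimal x : minimal_subsystem phi (orbit_level x).
Proof.
have Ecl : closed (orbit_level x).
  move=> y; rewrite /closure /= => /(_ _ (l_nbhs 0 y))[z [[n xz] /= zy]].
  by exists n; rewrite xz.
have Ephi y : orbit_level x y -> orbit_level x (phi y).
  by move=> [n xy]; exists n.+1; exact: l_phi.
split=> //.
- by exists x, 0%N.
- exact: subclosed_compact Ecl T_compact _.
- by move=> _ [y /Ephi Ey <-].
- move=> y Ey; apply/seteqP; split=> [z Ez|].
    move=> U /level_nbhs_basis[s sU].
    have [n yn] := orbit_level_reach s (orbit_level_shift Ey Ez).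
    by exists (iter n phi y); split; [exists n|apply: sU].
  rewrite [X in _ `<=` X](_ : _ = closure (orbit_level x)); last first.
    by apply/closure_id.
  by apply: closure_subset => _ [n _ <-]; elim: n => //= n; exact: Ephi.
Qed.

Lemma odometer_dvd s t (y : nat -> nat) : inverse_limit q y -> (s <= t)%N ->
  (y t = y s %[mod q s])%N.
Proof.
move=> yq /subnK <-; elim: (t - s)%N => [//|n IHn].
rewrite -IHn addSn; have [_ <-] := yq (n + s)%N.
by rewrite modn_dvdm// period_dvd// leq_addl.
Qed.

Lemma orbit_level_conjugate x :
  conjugate_to_adding_machine phi (orbit_level x) q.
Proof.
(* [n (y, s)] is a time at which the orbit of [x] agrees with [y] at level [s]. It is unique modulo
   [q s.+1], so these times form an address of [y]. *)
have /choice[n nP] (w : T * nat) : exists n, orbit_level x w.1 ->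
    l w.2 (iter n phi x) = l w.2 w.1.
  case: (pselect (orbit_level x w.1)) => [/(orbit_level_reach w.2)[n nE]|nE].
    by exists n.
  by exists 0%N.
pose h (y : T) : {ptws nat -> nat} := fun s => (n (y, s) %% q s)%N.
(* The point with address [y] is a cluster point of the iterates of [x] at the times [y i.+1], whose
   label at level [s] is constant for [i >= s]. *)
have /choice[k kP] (y : {ptws nat -> nat}) : exists z, inverse_limit q y ->
    forall s, l s z = l s (iter (y s.+1) phi x).
  have [z zP] := compact_seq_cluster (fun i => iter (y i.+1) phi x) T_compact.
  exists z => yq s; have [i si /= <-] := zP _ s (l_nbhs s z).
  by apply/level_iter_eq/odometer_dvd.
have nS y s : orbit_level x y -> (n (y, s.+1) = n (y, s) %[mod q s.+1])%N.
  move=> Ey; apply/(level_iter_eq _ x).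
  by rewrite (lS (nP (y, s.+1) Ey)) (nP (y, s)).
have hq y : orbit_level x y -> inverse_limit q (h y).
  move=> Ey s; split; first by rewrite ltn_mod.
  rewrite /h modn_dvdm// -(modn_dvdm _ (q_dvdS s)) (nS _ _ Ey).
  by rewrite modn_dvdm.
have hE y s : orbit_level x y -> l s (iter (h y s.+1) phi x) = l s y.
  move=> Ey; rewrite -(nP (y, s) Ey) /=; apply/(level_iter_eq _ x).
  by rewrite modn_mod nS.
have kE y : inverse_limit q y -> orbit_level x (k y).
  by move=> yq; exists (y 1%N); rewrite kP.
(* An address is determined by the labels it produces; this yields both [h (k y) = y] and the
   conjugacy. *)
have h_uniq y z : orbit_level x y -> inverse_limit q z ->
    (forall s, l s y = l s (iter (z s.+1) phi x)) -> h y = z.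
  move=> Ey zq yz; apply/funext => s; have [zs zsS] := zq s.
  have [_ <-] := hq _ Ey s; rewrite -zsS.
  rewrite -(modn_dvdm _ (q_dvdS s)) -[in RHS](modn_dvdm _ (q_dvdS s)).
  by congr (_ %% _)%N; apply/(level_iter_eq _ x); rewrite -yz hE.
have hk y : inverse_limit q y -> h (k y) = y.
  by move=> yq; apply: h_uniq => // [|s]; [exact: kE|exact: kP].
exists h, k; split=> //.
- move=> y Ey; apply: l_sep => s.
  by rewrite kP ?hE//; exact: hq.
- split.
    apply: within_continuous_ptws => y s Ey.
    apply: filterS (l_nbhs s y) => z /= zy Ez.
    have zyE : (n (z, s) = n (y, s) %[mod q s.+1])%N.
      by apply/(level_iter_eq _ x); rewrite (nP (z, s) Ez) (nP (y, s) Ey).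
    by rewrite /h -(modn_dvdm _ (q_dvdS s)) zyE modn_dvdm.
  apply/subspace_continuousP => y yq W Wky.
  have [s sW] := level_nbhs_basis Wky.
  apply: filterS (nbhs_ptws_coord y s.+1) => z /= zy zq; apply: sW.
  by rewrite !kP// zy.
- move=> y Ey; have [m ym] := Ey; apply: h_uniq.
  + by exists m.+1; exact: l_phi.
  + move=> s; rewrite /adding_machine ltn_mod; split=> //.
    rewrite modn_dvdm// -addn1 -modnDml.
    by have [_ ->] := hq _ Ey s; rewrite addn1.
  + move=> s; rewrite -(l_phi (hE y s Ey)) -iterS; apply/(level_iter_eq _ x).
    by rewrite /adding_machine modn_mod.
Qed.

Theorem odometer_decomposition (M : nat) :
  (forall u : F 0%N, exists x, l 0%N x = u) -> #|F 0%N| = (M * q 1)%N ->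
  exists2 E : 'I_M -> set T, minimal_decomposition phi E &
    forall i, conjugate_to_adding_machine phi (E i) q.
Proof.
move=> /choice[g gK] F0.
(* The map induced by [phi] on the classes of level 0; by [l_phi] it does not depend on the section
   [g]. *)
pose f u := l 0%N (phi (g u)).
have fE n u x : l 0%N x = u -> iter n f u = l 0%N (iter n phi x).
  by move=> <-; elim: n => //= n ->; apply: l_phi; rewrite gK.
have fn u k : (iter k f u == u) = (q 1 %| k)%N.
  rewrite (fE k u (g u))//; apply/eqP/idP => H.
    by apply/(l_period 0 (g u)); rewrite gK.
  by rewrite level_iter_dvd.
have [f_inj] := fcard_uniform_order fn (q_gt0 1).
rewrite F0 => /eqP; rewrite eqn_pmul2r// => /eqP fM.
have f_sym := fconnect_sym f_inj.
(* One root for each cycle of [f]; the roots index the components. *)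
pose A := [predI froots f & F 0%N].
have AM : #|A| = M by [].
pose r (i : 'I_M) : F 0%N := enum_val (cast_ord (esym AM) i).
have rP i : froot f (r i) = r i.
  by have := enum_valP (cast_ord (esym AM) i); rewrite inE => /andP[/eqP].
have EP i y : orbit_level (g (r i)) y <-> froot f (l 0%N y) = r i.
  split=> [[n ny]|yi].
    rewrite -(rP i); apply/eqP; rewrite (root_connect f_sym) f_sym.
    by rewrite -ny -(fE n (r i))// fconnect_iter.
  have /iter_findex : fconnect f (r i) (l 0%N y).
    by rewrite f_sym -yi connect_root.
  by rewrite (fE _ _ (g (r i)))// => ?; exists (findex f (r i) (l 0%N y)).
exists (fun i => orbit_level (g (r i))); last first.
  by move=> i; exact: orbit_level_conjugate.
split.
- by move=> i; exact: orbit_level_minimal.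
- move=> i j _ _ [y [/EP yi /EP yj]].
  by apply/(cast_ord_inj (eq_n := esym AM))/enum_val_inj; rewrite -/(r i) -yi.
- apply/seteqP; split=> // y _.
  have yA : froot f (l 0%N y) \in A.
    by apply/andP; split=> //; exact: roots_root.
  exists (cast_ord AM (enum_rank_in yA (froot f (l 0%N y)))) => //.
  by apply/EP; rewrite /r cast_ordK enum_rankK_in.
Qed.
End Odometer.

(** * Powers in a ramified quadratic order *)

Section PadicArithmetic.
Context (p : nat) (p_pr : prime p).
Local Notation Zp := (padic_int p_pr).
Implicit Types x y z u D A B : Zp.

Definition padic_dvd (n : nat) x := exists z, x = p%:R ^+ n * z.

Lemma padic_dvdP n x : padic_dvd n x <-> padic_res x n = 0%N.
Proof.
split=> [[z ->]|xn].
  by rewrite -natrX padic_resM padic_res_natr modnn mul0n mod0n.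
have [->|/padic_int_factor[k [u uU xE]]] := eqVneq x 0.
  by exists 0; rewrite mulr0.
have [nk|kn] := leqP n k.
  by exists (p%:R ^+ (k - n) * u); rewrite mulrA -exprD subnKC// xE.
(* With [x = p^k u] and [k < n], vanishing modulo [p^(k+1)] forces p to divide [u]. *)
suff : padic_res u 1 = 0%N.
  by move: uU; rewrite padic_unitE => /eqP.
have : padic_res x k.+1 = 0%N.
  by rewrite -(subnK kn) in xn; rewrite -(padic_resD x (n - k.+1)) xn mod0n.
rewrite xE -natrX padic_resM padic_res_natr modnMml => /eqP.
have pk : (p ^ k > 0)%N by rewrite expn_gt0 prime_gt0.
by rewrite -/(dvdn _ _) expnSr dvdn_pmul2l// /dvdn padic_res1_mod => /eqP ->.
Qed.

Lemma padic_res_eq n x y :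
  padic_res x n = padic_res y n <-> padic_dvd n (x - y).
Proof.
rewrite padic_dvdP; split=> [xy|].
  rewrite padic_ofE [padic_res (- y) n]padic_ofE -xy modnDmr.
  by rewrite subnKC ?modnn// ltnW// padic_res_lt.
move=> xy; have : padic_res (x - y + y) n = padic_res y n.
  by rewrite padic_ofE xy add0n padic_res_mod.
by rewrite subrK.
Qed.

Lemma padic_dvdD n x y : padic_dvd n x -> padic_dvd n y -> padic_dvd n (x + y).
Proof. by move=> [a ->] [b ->]; exists (a + b); rewrite mulrDr. Qed.

Lemma padic_dvdMr n x y : padic_dvd n x -> padic_dvd n (x * y).
Proof. by move=> [a ->]; exists (a * y); rewrite mulrA. Qed.

Lemma padic_dvdMl n x y : padic_dvd n y -> padic_dvd n (x * y).
Proof. by rewrite mulrC; exact: padic_dvdMr. Qed.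

Lemma padic_dvdMU n x u : u \is a GRing.unit ->
  padic_dvd n (x * u) <-> padic_dvd n x.
Proof.
move=> uU; split=> [/(padic_dvdMr (u^-1))|]; first by rewrite mulrK.
exact: padic_dvdMr.
Qed.

Lemma padic_int_p_neq0 : p%:R != 0 :> Zp.
Proof. by rewrite -[p%:R]expr1 padic_expp_neq0. Qed.

Lemma padic_dvdX n k u : u \is a GRing.unit ->
  padic_dvd n (p%:R ^+ k * u) <-> (n <= k)%N.
Proof.
move=> uU; rewrite padic_dvdMU//; split=> [[z]|nk].
  rewrite leqNgt => zE; apply/negP => kn; move: zE.
  rewrite -(subnKC kn) addSnnS exprD -mulrA -[LHS]mulr1.
  move/(mulfI (padic_expp_neq0 _ _)) => z1.
  have := unitr1 Zp; rewrite z1 exprS -mulrA unitrM.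
  by rewrite (negbTE (padic_natr_p _)).
by exists (p%:R ^+ (k - n)); rewrite -exprD subnKC.
Qed.

Lemma padic_dvd1U x : padic_dvd 1 x <-> x \isn't a GRing.unit.
Proof. by rewrite padic_dvdP padic_unitE; split=> [->|/negPn/eqP]. Qed.

Lemma padic_unitD x y : x \is a GRing.unit -> padic_dvd 1 y ->
  x + y \is a GRing.unit.
Proof.
move=> xU yp; apply/negPn/negP => /padic_dvd1U xyp.
have /padic_dvd1U : padic_dvd 1 x.
  by rewrite -(addrK y x) -mulN1r; apply: padic_dvdD => //; exact: padic_dvdMl.
by rewrite xU.
Qed.

Lemma padic_natU n : ((n%:R : Zp) \is a GRing.unit) = ~~ (p %| n)%N.
Proof. by rewrite padic_unitE padic_res_natr expn1. Qed.

(* [coord_pow D A B n] are the coordinates of [(A + B s) ^ n] on [1] and [s],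
   where [s ^ 2 = D]. *)
Definition coord_pow D A B n : Zp * Zp :=
  iter n (fun a => (a.1 * A + D * a.2 * B, a.1 * B + a.2 * A)) (1, 0).

Lemma coord_powD D A B m n :
  let a := coord_pow D A B m in let b := coord_pow D A B n in
  coord_pow D A B (m + n) = (a.1 * b.1 + D * a.2 * b.2, a.1 * b.2 + a.2 * b.1).
Proof.
elim: m => [|m IHm] /=.
  by rewrite mulr0 !mul0r mul1r mul1r !addr0; case: coord_pow.
by rewrite -/(coord_pow D A B (m + n)) IHm /=; congr pair; ring.
Qed.

Lemma coord_powM D A B m n : let a := coord_pow D A B m in
  coord_pow D A B (n * m) = coord_pow D a.1 a.2 n.
Proof.
elim: n => [//|n IHn] /=.
by rewrite mulSn addnC coord_powD IHn.
Qed.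

(** Binomial expansion: the terms of degree at least 2 in [B s] contain [(B s)^2 = D B^2]. For
    [n = 0] the coefficient [n] kills the junk exponent [n.-1]. *)
Lemma coord_pow_expansion D A B n : exists t r,
  (coord_pow D A B n).1 = A ^+ n + D * B ^+ 2 * t /\
  (coord_pow D A B n).2 = B * (n%:R * A ^+ n.-1 + D * B ^+ 2 * r).
Proof.
elim: n => [|n [t [r [tE rE]]]].
  by exists 0, 0; split=> /=; rewrite ?mulr0 ?addr0// mul0r mulr0.
exists (t * A + n%:R * A ^+ n.-1 + D * B ^+ 2 * r), (t + r * A).
rewrite /= -/(coord_pow D A B n) tE rE.
split; first by rewrite (exprSr A n); ring.
rewrite -natr1; case: n {tE rE} => [|n] /=; first by ring.
by rewrite (exprSr A n); ring.
Qed.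

Section TranslationValuation.
Variables (D B : Zp) (m : nat) (w : Zp).
Hypothesis Dp : padic_dvd 1 D.
Hypothesis wU : w \is a GRing.unit.
Local Notation An n := (coord_pow D 1 B n).1.
Local Notation Bn n := (coord_pow D 1 B n).2.
Hypothesis BpE : Bn p = p%:R ^+ m * w.

Lemma coord_pow1_sub1 n : padic_dvd 1 (An n - 1).
Proof.
have [t [r [-> _]]] := coord_pow_expansion D 1 B n.
by rewrite expr1n addrC addKr -mulrA; exact: padic_dvdMr.
Qed.

Lemma coord_pow1_unit n : An n \is a GRing.unit.
Proof.
rewrite -[An n](subrK 1) addrC; apply: padic_unitD (coord_pow1_sub1 n).
exact: unitr1.
Qed.

(** As p divides [D], the cofactor of [C] is [n A^(n-1)] modulo p, which is a unit. *)
Lemma coord_pow_coprime A C n : A \is a GRing.unit -> ~~ (p %| n)%N ->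
  exists2 v, v \is a GRing.unit & (coord_pow D A C n).2 = C * v.
Proof.
move=> AU np; have [t [r [_ ->]]] := coord_pow_expansion D A C n.
exists (n%:R * A ^+ n.-1 + D * C ^+ 2 * r) => //; apply: padic_unitD.
  by rewrite unitrM padic_natU np unitrX.
by rewrite -mulrA; exact: padic_dvdMr.
Qed.

(** With [C = p c], the cofactor of [p C] is [A^(p-1) + D C c r], a unit since p divides [D]. If p
    did not divide [C], the p in [D] would be used up and the cofactor might not be a unit. *)
Lemma coord_pow_p A C : A \is a GRing.unit -> padic_dvd 1 C ->
  exists2 v, v \is a GRing.unit & (coord_pow D A C p).2 = p%:R * C * v.
Proof.
move=> AU [c CE]; have [t [r [_ ->]]] := coord_pow_expansion D A C p.
rewrite expr1 in CE; exists (A ^+ p.-1 + D * C * c * r); last first.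
  by rewrite !CE; ring.
apply: padic_unitD; first exact: unitrX.
by rewrite -!mulrA; exact: padic_dvdMr.
Qed.

Lemma coord_pow1_p_dvd : exists2 b, padic_dvd 1 b & Bn p = B * b.
Proof.
have [t [r [_ ->]]] := coord_pow_expansion D 1 B p.
exists (p%:R * 1 ^+ p.-1 + D * B ^+ 2 * r) => //; apply: padic_dvdD.
  by apply: padic_dvdMr; exists 1; rewrite expr1 mulr1.
by rewrite -mulrA; exact: padic_dvdMr.
Qed.

(** [B_p] is [B] times a multiple of p. Hence [m.-1] in the count is a true subtraction. *)
Lemma coord_pow1_val_gt0 : (0 < m)%N.
Proof.
have [b bp BE] := coord_pow1_p_dvd; apply/(padic_dvdX 1 m wU); rewrite -BpE BE.
exact: padic_dvdMl.
Qed.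

(** Exponent p gives valuation [m] by hypothesis. Each further factor p adds 1 by [coord_pow_p], the
    coordinate being now divisible by p, and the factor [n] adds nothing. *)
Lemma coord_pow_val i n : ~~ (p %| n)%N -> exists2 v, v \is a GRing.unit &
  Bn (n * p ^ i.+1) = p%:R ^+ (m + i) * v.
Proof.
have pow i' : exists2 v, v \is a GRing.unit &
    Bn (p ^ i'.+1) = p%:R ^+ (m + i') * v.
  elim: i' => [|i' [v vU IH]]; first by exists w; rewrite // addn0.
  rewrite expnS coord_powM; set A := An _; set C := Bn _.
  have [|v' v'U ->] := @coord_pow_p A C (coord_pow1_unit _).
    rewrite /C IH; apply/padic_dvdX => //.
    by rewrite addn_gt0 coord_pow1_val_gt0.
  exists (v * v'); first by rewrite unitrM vU.
  by rewrite /C IH addnS exprS; ring.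
move=> np; rewrite coord_powM; have [v vU vE] := pow i.
have [v' v'U ->] :=
  coord_pow_coprime (Bn (p ^ i.+1)) (coord_pow1_unit (p ^ i.+1)) np.
by exists (v * v'); rewrite ?unitrM ?vU// vE mulrA.
Qed.

Lemma padic_dvd_coord_pow j n :
  padic_dvd (m + j) (Bn n) <-> (p ^ j.+1 %| n)%N.
Proof.
have [->|n0] := posnP n.
  by rewrite dvdn0; split=> // _; exists 0; rewrite mulr0.
have [pn|pn] := boolP (p %| n)%N; last first.
  (* For [n] prime to p, [p^(m+j) | B_n] would give [p^(m+j) | B], hence [p^(m+j+1) | B_p], against
     the valuation [m] of [B_p]. *)
  split=> [H|]; last first.
    by move/(dvdn_trans (dvdn_exp (ltn0Sn j) (dvdnn p))); rewrite (negbTE pn).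
  have [v vU BnE] := coord_pow_coprime B (unitr1 Zp) pn.
  have [b /padic_dvd1U bN BE] := coord_pow1_p_dvd.
  move: H; rewrite BnE padic_dvdMU// => -[c cE].
  have : p%:R ^+ m * w = p%:R ^+ m * (p%:R ^+ j * c * b).
    by rewrite -BpE BE cE exprD; ring.
  move/(mulfI (padic_expp_neq0 _ _)) => wE.
  by move: wU; rewrite wE unitrM (negbTE bN) andbF.
have [n' cop nE] := pfactor_coprime p_pr n0.
rewrite prime_coprime// in cop.
case: (logn p n) nE => [|i] nE.
  by move: pn; rewrite nE muln1 (negbTE cop).
rewrite nE.
have [v vU ->] := coord_pow_val i cop.
rewrite padic_dvdX// leq_add2l Gauss_dvdr ?coprimeXl ?prime_coprime//.
by rewrite dvdn_Pexp2l ?prime_gt1.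
Qed.
End TranslationValuation.
End PadicArithmetic.

(** * Dynamics of the translation on two copies of Z_p *)

Section TranslationDynamics.
Context (p : nat) (p_pr : prime p) (p_odd : odd p).
Local Notation Zp := (padic_int p_pr).
(* [delta] tells whether the two charts are exchanged. *)
Context (D B w : Zp) (m : nat) (delta : bool).
Hypothesis Dp : padic_dvd 1 D.
Hypothesis wU : w \is a GRing.unit.
Hypothesis BpE : (coord_pow D 1 B p).2 = p%:R ^+ m * w.
Local Notation An n := (coord_pow D 1 B n).1.
Local Notation Bn n := (coord_pow D 1 B n).2.

Context (T : topologicalType) (phi : T -> T).
Context (theta : bool * Zp -> T) (thetaV : T -> bool * Zp).
Hypothesis T_compact : compact [set: T].
Hypothesis thetaK : cancel theta thetaV.
Hypothesis thetaVK : cancel thetaV theta.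
(** The formula is [(1 + B s) (1 + y s) = (1 + D B y) + (y + B) s], rescaled to have coefficient 1
    on 1. *)
Hypothesis phi_theta : forall (e : bool) (y : Zp),
  phi (theta (e, y)) = theta (e (+) delta, (y + B) / (1 + D * B * y)).
Hypothesis theta_nbhs : forall s x, nbhs x [set y | (thetaV y).1 = (thetaV x).1
  /\ padic_dvd s ((thetaV y).2 - (thetaV x).2)].

Let den n (y : Zp) : An n + D * Bn n * y \is a GRing.unit.
Proof.
apply: padic_unitD (coord_pow1_unit _ Dp n) _.
by rewrite -mulrA; exact: padic_dvdMr.
Qed.

Let den1 (C y : Zp) : 1 + D * C * y \is a GRing.unit.
Proof.
by apply: padic_unitD (unitr1 _) _; rewrite -mulrA; exact: padic_dvdMr.
Qed.

Lemma iter_phi_theta n (e : bool) y : iter n phi (theta (e, y)) =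
  theta (e (+) (odd n && delta), (An n * y + Bn n) / (An n + D * Bn n * y)).
Proof.
elim: n => [|n IHn] /=.
  by rewrite addbF mulr0 mul0r !addr0 mul1r divr1.
rewrite IHn phi_theta -addbA; congr (theta (_, _)).
  by case: odd; case: delta.
rewrite -/(coord_pow D 1 B n); set A := An n; set C := Bn n.
set z := (A * y + C) / _; have dU : A + D * C * y \is a GRing.unit := den n y.
have zE : z * (A + D * C * y) = A * y + C by rewrite /z mulrVK.
have -> : (z + B) / (1 + D * B * z) =
    ((z + B) * (A + D * C * y)) / ((1 + D * B * z) * (A + D * C * y)).
  by rewrite (invrM (den1 B z) dU) [RHS]mulrA (mulrK dU).
rewrite (mulrDl z) (mulrDl 1) -(mulrA _ z) zE; congr (_ / _); ring.
Qed.

(** The numerator of the difference is [y - y'] times the determinant [1 - D B^2], and the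
    denominators are units. *)
Lemma phi_theta_dvd (y y' : Zp) n : padic_dvd n (y - y') ->
  padic_dvd n ((y + B) / (1 + D * B * y) - (y' + B) / (1 + D * B * y')).
Proof.
move=> yy'; apply/(padic_dvdMU n _ (den1 B y))/(padic_dvdMU n _ (den1 B y')).
rewrite !mulrBl (mulrVK (den1 B y)) (mulrAC _ (1 + _)) (mulrVK (den1 B y')).
have -> : (y + B) * (1 + D * B * y') - (y' + B) * (1 + D * B * y) =
  (y - y') * (1 - D * B ^+ 2) by ring.
exact: padic_dvdMr.
Qed.

Let l s x : bool * 'I_(p ^ (m + s)) :=
  ((thetaV x).1, Ordinal (padic_res_lt (thetaV x).2 (m + s))).

Lemma levelE s x y : l s x = l s y <-> (thetaV x).1 = (thetaV y).1 /\
  padic_dvd (m + s) ((thetaV x).2 - (thetaV y).2).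
Proof.
rewrite -padic_res_eq; split=> [[-> ->]//|[e r]].
by rewrite /l e; congr pair; apply: val_inj.
Qed.

Let q s := if delta then (2 * p ^ s)%N else (p ^ s)%N.

Lemma period_dvdn s n : (q s %| n)%N = ~~ (odd n && delta) && (p ^ s %| n)%N.
Proof.
rewrite /q; case: delta; last by rewrite andbF.
by rewrite andbT Gauss_dvd ?dvdn2// coprimeXr// coprime2n.
Qed.

(** As [1 - D y^2], the norm of [1 + y s], is a unit, [y] is fixed modulo a power of p exactly when
    that power divides [B_n]. *)
Lemma iter_displacement n (y : Zp) :
  ((An n * y + Bn n) / (An n + D * Bn n * y) - y) * (An n + D * Bn n * y) =
  Bn n * (1 - D * y ^+ 2).
Proof. by rewrite mulrBl (mulrVK (den n y)); ring. Qed.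

Lemma level_periodic s x n : l s (iter n phi x) = l s x <-> (q s.+1 %| n)%N.
Proof.
rewrite levelE -(thetaVK x); case: (thetaV x) => e y.
rewrite iter_phi_theta !thetaK /= period_dvdn -(padic_dvdMU _ _ (den n y)).
rewrite iter_displacement padic_dvdMU; last first.
  by rewrite (_ : _ - _ = 1 + D * (- y) * y) ?den1//; ring.
rewrite (padic_dvd_coord_pow Dp wU BpE).
split=> [[ee ->]|/andP[+ ->]].
  by rewrite andbT; move: ee; case: e; case: (_ && _).
by case: (odd n && delta) => // _; rewrite addbF.
Qed.

Lemma level_transitive s x y : l s x = l s y ->
  exists n, l s.+1 (iter n phi x) = l s.+1 y.
Proof.
rewrite levelE -(thetaVK x) -(thetaVK y) !thetaK.
case: (thetaV x) (thetaV y) => [e x'] [e' y'] /= [-> [d dE]] {x y}.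
have [D' D'E] := Dp; rewrite expr1 in D'E.
(* [N = c p^(s+1)] steps move a point by [p^(m+s)] times a unit; the factor 2 makes [N] even, so
   that these steps preserve the chart. *)
pose c := if delta then 2%N else 1%N.
have pc : ~~ (p %| c)%N.
  have p1 := prime_gt1 p_pr; rewrite /c; case: delta; rewrite gtnNdvd//.
  by case: (p) p1 p_odd => [|[|[|]]].
have [v vU vE] := coord_pow_val Dp wU BpE s pc.
(* To first order, [j N] steps add [j v p^(m+s)] to [x'], while [x' - y' = p^(m+s) d]. The next
   digit therefore agrees when [j = - d / v] modulo p. *)
pose f := - (d / v).
have dfE : d = - (v * f) by rewrite /f mulrN opprK mulrC mulrVK.
pose j := padic_res f 1.
have [j1 j1E] : padic_dvd 1 (j%:R - f).
  by apply/padic_res_eq; rewrite padic_res_natr modn_small ?padic_res_lt.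
have {}j1E : j%:R = f + p%:R * j1 by rewrite -[p%:R]expr1 -j1E addrC subrK.
pose N := (c * p ^ s.+1)%N.
have [t [r [_ rE]]] := coord_pow_expansion D (An N) (Bn N) j.
have [A1 A1E] := coord_pow1_sub1 B Dp N.
have [a aE] : exists a, An N ^+ j.-1 = 1 + p%:R * a.
  elim: j.-1 => [|k [a aE]]; first by exists 0; rewrite mulr0 addr0.
  have AE : An N = 1 + p%:R * A1 by rewrite -[p%:R]expr1 -A1E addrC subrK.
  by exists (a + A1 + p%:R * a * A1); rewrite exprS aE AE; ring.
rewrite -coord_powM in rE.
exists (j * N)%N.
rewrite levelE iter_phi_theta !thetaK /=; split.
  have -> : odd (j * N) && delta = false.
    by rewrite /N /c; case: delta; rewrite ?andbF// !oddM /= andbF.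
  by rewrite addbF.
set n := (j * N)%N; apply/(padic_dvdMU _ _ (den n x')).
have [e1 e1E] := coord_pow1_sub1 B Dp n.
have denE : An n + D * Bn n * x' = 1 + p%:R * (e1 + D' * Bn n * x').
  by rewrite -[An n](subrK 1) e1E D'E; ring.
set z := _ / _.
have zE : (z - x') * (An n + D * Bn n * x') = Bn n * (1 - D * x' ^+ 2).
  exact: iter_displacement.
have -> : z - y' = (z - x') + p%:R ^+ (m + s) * d by rewrite -dE; ring.
rewrite mulrDl zE denE.
set h := e1 + _; set C := p%:R ^+ (m + s).
pose g := f * a + j1 * (1 + p%:R * a) + D' * (C * v) ^+ 2 * r.
have -> : Bn n = C * v * (f + p%:R * g).
  by rewrite rE vE aE j1E -/C [X in X * _ ^+ 2 * r]D'E /g; ring.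
have -> : D * x' ^+ 2 = p%:R * D' * x' ^+ 2 by rewrite -D'E.
exists (v * (g * (1 - p%:R * D' * x' ^+ 2) - f * D' * x' ^+ 2 - f * h)).
by rewrite dfE addnS (exprS _ (m + s)) -/C; ring.
Qed.

Theorem translation_decomposition :
  exists2 E : 'I_((if delta then 1 else 2) * p ^ m.-1) -> set T,
    minimal_decomposition phi E &
    forall i, conjugate_to_adding_machine phi (E i)
      (fun s => if delta then (2 * p ^ s)%N else (p ^ s)%N).
Proof.
have m0 := coord_pow1_val_gt0 Dp wU BpE.
have p0 s : (0 < p ^ s)%N by rewrite expn_gt0 prime_gt0.
apply: (@odometer_decomposition T phi _ l).
- exact: T_compact.
- move=> s x; apply: filterS (theta_nbhs (m + s) x) => y yx.
  by apply/levelE.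
- move=> x y xy; rewrite -(thetaVK x) -(thetaVK y); congr theta.
  have [xy1 _] := (levelE _ _ _).1 (xy 0%N).
  rewrite [LHS]surjective_pairing [RHS]surjective_pairing xy1; congr pair.
  apply/padic_intP => s; apply/padic_res_eq.
  have [_ [d dE]] := (levelE _ _ _).1 (xy s).
  by rewrite dE addnC exprD -mulrA; exists (p%:R ^+ m * d).
- move=> s x y /levelE[xy [d dE]]; apply/levelE; split=> //.
  by rewrite dE addnS exprSr -mulrA; exists (p%:R * d).
- move=> s x y /levelE[xy xyd]; apply/levelE.
  rewrite -(thetaVK x) -(thetaVK y).
  case: (thetaV x) (thetaV y) xy xyd => [e x'] [e' y'] /= -> xyd.
  rewrite !phi_theta !thetaK; split=> //.
  exact: phi_theta_dvd.
- exact: level_periodic.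
- exact: level_transitive.
- by move=> s; case: delta; rewrite ?muln_gt0/=.
- by move=> s; case: delta; rewrite ?dvdn_pmul2l// dvdn_exp2l.
- move=> [e u]; have uE : padic_res (u%:R : Zp) (m + 0) = u.
    by rewrite padic_res_natr modn_small.
  exists (theta (e, u%:R)); rewrite /l thetaK; congr pair; exact: val_inj.
(* [2 p^m] classes, on cycles of length [p] or [2 p]. *)
- rewrite card_prod card_bool card_ord addn0 -{1}(prednK m0) expn1.
  by rewrite expnSr; case: delta; rewrite ?mul1n ?mulnA// mulnAC mulnC mulnA.
Qed.

End TranslationDynamics.

(** * The projective line *)

Section PadicTopology.
Context (p : nat) (p_pr : prime p).
Local Notation Zp := (padic_int p_pr).
Local Notation Qp := (padic p_pr).
Local Notation "x %:F" := (@FracField.tofrac (padic_int p_pr) x : Qp).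

Lemma tofracX_p n : (p%:R ^+ n : Zp)%:F = p%:R ^+ n.
Proof. by rewrite rmorphXn rmorph_nat. Qed.

Lemma padic_abs_le1 (R : realFieldType) (x : Qp) :
  padic_abs x <= 1 :> R <-> exists z : Zp, x = z%:F.
Proof.
have p1 : 1 < p%:R :> R by rewrite ltr1n prime_gt1.
split=> [|[z ->]].
  have [-> _|x0] := eqVneq x 0; first by exists 0; rewrite rmorph0.
  have [n [u uU ->]] := padic_factor x0.
  rewrite padic_absE// -[leRHS](expr0z p%:R) ler_eXz2l// oppr_le0 => n0.
  case: n n0 => // n _; exists (p%:R ^+ n * u).
  by rewrite rmorphM /= tofracX_p.
have [->|/padic_int_factor[n [u uU ->]]] := eqVneq z 0.
  by rewrite rmorph0 padic_abs0.
rewrite rmorphM /= tofracX_p exprnP padic_absE//.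
by rewrite -[leRHS](expr0z p%:R) ler_eXz2l// oppr_le0.
Qed.

Lemma nbhs_padic (x : Qp) (W : set Qp) :
  nbhs x W <-> exists N, forall z : Zp, W (x + p%:R ^+ N * z%:F).
Proof.
have p1 : 1 < p%:R :> rat by rewrite ltr1n prime_gt1.
have p0 : 0 < p%:R :> rat by rewrite ltr0n prime_gt0.
have pN N : padic_abs (p%:R ^+ N : Qp) = p%:R ^- N :> rat.
  have := @padic_absE _ p_pr rat N 1 (unitr1 _).
  by rewrite rmorph1 mulr1 exprnN.
split=> [/nbhs_ballP[e /= e0 eW]|[N NW]].
  have [N eN] : exists N, e^-1 < p%:R ^+ N.
    (* The Archimedean bound serves as an exponent because [n < p^n]. *)
    exists (Num.bound e^-1); apply: lt_trans (archi_boundP _) _.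
      by rewrite invr_ge0 ltW.
    rewrite -natrX ltr_nat.
    exact: ltn_expl (prime_gt1 p_pr).
  exists N => z; apply: eW; rewrite /ball /= /padic_ball.
  rewrite opprD addNKr padic_absN padic_absM.
  rewrite pN; apply: (@le_lt_trans _ _ (p%:R ^- N)).
    apply: ler_piMr; first by rewrite invr_ge0 exprn_ge0// ltW.
    by apply/(padic_abs_le1 rat); exists z.
  by rewrite -[e]invrK ltf_pV2 ?posrE ?invr_gt0// exprn_gt0.
apply/nbhs_ballP; exists (p%:R ^- N) => /=; first by rewrite invr_gt0 exprn_gt0.
move=> y; rewrite /ball /= /padic_ball => yx.
have pN0 : p%:R ^+ N != 0 :> Qp by rewrite expf_neq0// padic_p_neq0.
have /(padic_abs_le1 rat)[z zE] : padic_abs ((y - x) / p%:R ^+ N) <= 1 :> rat.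
  rewrite -(@ler_pM2r _ (p%:R ^- N)) ?invr_gt0 ?exprn_gt0// mul1r -{1}pN.
  by rewrite -padic_absM divfK// -opprB padic_absN ltW.
have -> : y = x + p%:R ^+ N * z%:F by rewrite -zE mulrC divfK// addrC subrK.
exact: NW.
Qed.

(** Closed in a product of finite sets, since each compatibility condition involves only two
    coordinates. *)
Lemma inverse_limit_compact (q : nat -> nat) : compact (inverse_limit q).
Proof.
pose P : set {ptws nat -> nat} := [set f | forall i, (f i < q i)%N].
have cP : compact P.
  apply: (@tychonoff nat (fun=> nat) (fun i => [set n | (n < q i)%N])) => i.
  apply: finite_compact; exact: finite_II.
apply: subclosed_compact cP _ => [y|y yq s]; last by have [] := yq s.
rewrite /closure /= => yq s.
have nb := filterI (nbhs_ptws_coord y s) (nbhs_ptws_coord y s.+1).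
by have [z [zq [/= <- <-]]] := yq _ (nb _); exact: zq.
Qed.

(** Serves to write [p^|n| = p^n p^k] with [k] natural, whatever the sign of [n]. *)
Lemma absz_sub_nat (n : int) : exists k : nat, (`|n|%N : int) = n + k%:Z.
Proof.
case: n => i; first by exists 0%N; rewrite addr0.
by exists (i.+1 + i.+1)%N; rewrite NegzE PoszD addKr.
Qed.

Lemma nbhs_padic_coset (x g : Qp) : g != 0 ->
  nbhs x [set x + g * z%:F | z in [set: Zp]].
Proof.
move=> /padic_factor[n [u uU gE]]; apply/nbhs_padic; exists `|n|%N => z.
have p0 := padic_p_neq0 p_pr.
have [k kE] := absz_sub_nat n.
exists (p%:R ^+ k * u^-1 * z) => //; congr (_ + _).
rewrite (exprnP (p%:R : Qp)) kE expfzDr// gE !rmorphM /= tofracX_p -!mulrA.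
congr (_ * _).
by rewrite mulrCA; congr (_ * _); rewrite mulrA -rmorphM divrr// rmorph1 mul1r.
Qed.

Lemma padic_coset_compact (x g : Qp) :
  compact [set x + g * z%:F | z in [set: Zp]].
Proof.
have [->|g0] := eqVneq g 0.
  rewrite [X in compact X](_ : _ = [set x]); first exact: compact_set1.
  by apply/seteqP; split=> [_ [z _ <-]|_ ->]/=; [|exists 0]; rewrite ?mul0r ?addr0.
(* [insubd] extends the map to all sequences; the default 0 is never taken on the inverse limit. *)
pose F (f : {ptws nat -> nat}) : Qp := 
  x + g * (insubd (0 : Zp) f)%:F.
rewrite [X in compact X](_ : _ = F @` inverse_limit (expn p)); last first.
  apply/seteqP; split=> [_ [z _ <-]|_ [f fP <-]].
    exists (val z); first by have /set_mem := valP z.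
    by rewrite /F valKd.
  by exists (insubd (0 : Zp) f).
apply: continuous_compact; last exact: inverse_limit_compact.
apply/subspace_continuousP => f fP W /nbhs_padic[N NW].
have [n [u uU gE]] := padic_factor g0.
(* The extra [|n|] digits compensate for a factor [g] of negative valuation. *)
apply: filterS (nbhs_ptws_coord f (N + `|n|)) => f' /= ff' fP'.
pose G (h : nat -> nat) : Zp := insubd (0 : Zp) h.
have GE (h : {ptws nat -> nat}) s :
    inverse_limit (expn p) h -> padic_res (G h) s = h s.
  move=> /mem_set hP; have GhE : val (G h) = h by rewrite insubdK.
  by rewrite -[in RHS]GhE.
have /padic_res_eq[z zE] : padic_res (G f') (N + `|n|) =
    padic_res (G f) (N + `|n|).
  by rewrite !GE.
have p0 := padic_p_neq0 p_pr.
have [k] := absz_sub_nat (- n); rewrite abszN => kE.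
have {}kE : k%:Z = n + `|n|%N by rewrite kE addNKr.
suff -> : from_subspace (inverse_limit (expn p)) F f' =
    F f + p%:R ^+ N * (p%:R ^+ k * u * z)%:F by exact: NW.
rewrite /from_subspace /F -/(G f) -/(G f') -(subrK (G f) (G f')) zE.
rewrite rmorphD mulrDr addrCA [LHS]addrC; congr (_ + _).
have kX : p%:R ^+ k = p%:R ^ n * p%:R ^+ `|n| :> Qp.
  by rewrite (exprnP _ k) kE expfzDr.
rewrite gE exprD !rmorphM /= !tofracX_p kX; ring.
Qed.

End PadicTopology.

Lemma mul_div_cancel (F : fieldType) (k P z : F) :
  P != 0 -> k / P * (P * z) = k * z.
Proof. by move=> P0; field. Qed.

Lemma mul_sub_shift (R : comPzRingType) (x g y z : R) :
  x + g * (y - z) = x + g * y - g * z.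
Proof. by ring. Qed.

Lemma inv_pow_split (F : fieldType) (k P Q V : F) :
  P != 0 -> Q != 0 -> V != 0 -> k / (P * Q) * (P / V) = k / (Q * V).
Proof. by move=> P0 Q0 V0; field; rewrite ?P0 ?Q0 ?V0. Qed.

Lemma inv_shift (F : fieldType) (k b P T Y V : F) :
  Y != 0 -> V != 0 -> V = 1 + P * T * Y ->
  k / Y + b + k * P * T = k / (Y / V) + b.
Proof. by move=> Y0 V0 VE; rewrite invf_div VE; field. Qed.

(** * The two charts of the projective line *)

Section Chart.
Context (p : nat) (p_pr : prime p).
Local Notation Zp := (padic_int p_pr).
Local Notation Qp := (padic p_pr).
Local Notation "x %:F" := (@FracField.tofrac (padic_int p_pr) x : Qp).
Implicit Types x y z u v : Zp.

Lemma tofrac_mul x y : (x * y)%:F = x%:F * y%:F.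
Proof. exact: rmorphM. Qed.

Lemma tofrac_add x y : (x + y)%:F = x%:F + y%:F.
Proof. exact: rmorphD. Qed.

Lemma tofrac_opp x : (- x)%:F = - x%:F.
Proof. exact: rmorphN. Qed.

Lemma tofrac_one : (1 : Zp)%:F = 1.
Proof. exact: rmorph1. Qed.

Lemma tofrac_zero : (0 : Zp)%:F = 0.
Proof. exact: rmorph0. Qed.

Lemma tofrac_inj x y : x%:F = y%:F -> x = y.
Proof. by move=> /eqP; rewrite tofrac_eq => /eqP. Qed.

Lemma tofrac_neq0 x : x != 0 -> x%:F != 0.
Proof. by rewrite tofrac_eq0. Qed.

Lemma tofrac_div x u : u \is a GRing.unit -> (x / u)%:F = x%:F / u%:F.
Proof.
move=> uU; apply: (canRL (mulfK (padic_tofrac_neq0 uU))).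
by rewrite -tofrac_mul divrK.
Qed.

Lemma padic_unit_neq0 u : u \is a GRing.unit -> u != 0.
Proof. by apply: contraTneq => ->; rewrite unitr0. Qed.

Context (D u : Zp) (kappa beta : Qp).
Hypothesis uU : u \is a GRing.unit.
Hypothesis DE : D = p%:R * u.
Hypothesis kappa0 : kappa != 0.

(* In the coordinate [z = (x - beta) / kappa], [chart (false, y)] is [1 / y]
   and [chart (true, y)] is [D y]; they parametrize [|z| >= 1] and [|z| < 1]. *)
Definition chart (w : bool * Zp) : padic_P1 p_pr :=
  if w.1 then Some (kappa * (D * w.2)%:F + beta) else
  if w.2 == 0 then None else Some (kappa / w.2%:F + beta).

Lemma chart_D0 : D != 0.
Proof.
rewrite DE mulf_eq0 negb_or padic_int_p_neq0/=.
exact: padic_unit_neq0.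
Qed.

Lemma chart_DNU : D \isn't a GRing.unit.
Proof. by rewrite DE unitrM negb_and padic_natr_p. Qed.

Lemma chart_dvd : padic_dvd 1 D.
Proof. by exists u; rewrite expr1. Qed.

(** Equality would give [D y' y = 1] and make [D] a unit. *)
Lemma chart_mixed (y y' : Zp) : y != 0 ->
  kappa / y%:F + beta <> kappa * (D * y')%:F + beta.
Proof.
move=> y0 /addIr/(mulfI kappa0) yy'.
have D1 : D * y' * y = 1.
  apply: tofrac_inj; rewrite tofrac_mul tofrac_one -yy'.
  exact: mulVf (tofrac_neq0 y0).
by have := unitr1 Zp; rewrite -D1 -mulrA unitrM (negbTE chart_DNU).
Qed.

Lemma chart_inj : injective chart.
Proof.
move=> [[] y] [[] y']; rewrite /chart /=.
- by move=> [] /addIr/(mulfI kappa0)/tofrac_inj/(mulfI chart_D0) ->.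
- by case: eqP => // /eqP y0 [] /esym/(chart_mixed y0).
- by case: eqP => // /eqP y0 [] /(chart_mixed y0).
- case: eqP => [->|y0]; case: eqP => [->|y'0]//.
  by move=> [] /addIr/(mulfI kappa0)/invr_inj/tofrac_inj ->.
Qed.

Lemma chart_surj (X : padic_P1 p_pr) : exists w, chart w = X.
Proof.
case: X => [x|]; last by exists (false, 0); rewrite /chart/= eqxx.
pose z := (x - beta) / kappa.
have xE : x = kappa * z + beta by rewrite /z mulrC divfK// subrK.
have [z0|z0] := eqVneq z 0.
  by exists (true, 0); rewrite /chart /= mulr0 rmorph0 xE z0.
(* The valuation of [z] is zero, positive or negative; in the positive case one p goes into [D]. *)
have [n [v vU zE]] := padic_factor z0; case: n zE => [[|n]|n] zE.
- have vN0 : v^-1 != 0 by rewrite invr_eq0 padic_unit_neq0.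
  exists (false, v^-1); rewrite /chart /= (negbTE vN0) xE zE expr0z mul1r.
  by rewrite -[v^-1]mul1r tofrac_div// tofrac_one mul1r invrK.
- exists (true, p%:R ^+ n * v / u); rewrite /chart /= xE zE DE.
  have -> : p%:R * u * (p%:R ^+ n * v / u) = p%:R ^+ n.+1 * v.
    by rewrite -[RHS]mulr1 -(mulrV uU) exprS; ring.
  by rewrite tofrac_mul tofracX_p.
- have pvN0 : p%:R ^+ n.+1 * v^-1 != 0.
    by rewrite mulf_neq0 ?padic_expp_neq0// invr_eq0 padic_unit_neq0.
  exists (false, p%:R ^+ n.+1 * v^-1); rewrite /chart /= (negbTE pvN0) xE zE.
  rewrite tofrac_div// tofracX_p NegzE -exprnN.
  by congr (Some (_ * _ + _)); rewrite invf_div mulrC.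
Qed.

Definition chartV (X : padic_P1 p_pr) : bool * Zp :=
  xget (false, 0) [set w | chart w = X].

Lemma chartVK : cancel chartV chart.
Proof. by move=> X; exact: (xgetPex (false, 0) (chart_surj X)). Qed.

Lemma chartK : cancel chart chartV.
Proof. by move=> w; apply: chart_inj; rewrite chartVK. Qed.

(** This is continuity of the inverse of [chart]: nearby points share the chart and the parameter
    modulo [p^s]. *)
Lemma nbhs_chart s (w : bool * Zp) : nbhs (chart w)
  [set chart (w.1, w.2 + p%:R ^+ s * t) | t in [set: Zp]].
Proof.
have p0 : p%:R != 0 :> Qp := padic_p_neq0 p_pr.
case: w => e y /=; case: e.
  have g0 : kappa * D%:F * p%:R ^+ s != 0.
    exact: mulf_neq0 (mulf_neq0 kappa0 (tofrac_neq0 chart_D0)) (expf_neq0 _ p0).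
  apply: filterS (nbhs_padic_coset (kappa * (D * y)%:F + beta) g0) => _ [t _ <-].
  exists t => //; rewrite /chart /=; congr Some.
  by rewrite mulrDr tofrac_add !tofrac_mul tofracX_p; ring.
have [->|y0] := eqVneq y 0; last first.
  rewrite /chart /= (negbTE y0).
  (* Adding [kappa p^(s+1) t] to [kappa / y] replaces [y] by [y / (1 + p^(s+1) t y)]. The exponent
     [s.+1] makes this denominator a unit even for [s = 0]. *)
  have g0 : kappa * p%:R ^+ s.+1 != 0 := mulf_neq0 kappa0 (expf_neq0 _ p0).
  apply: filterS (nbhs_padic_coset (kappa / y%:F + beta) g0) => _ [t _ <-].
  have vU : 1 + p%:R ^+ s.+1 * t * y \is a GRing.unit.
    by apply: padic_unitD (unitr1 _) _; exists (p%:R ^+ s * t * y);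
      rewrite expr1 exprS -!mulrA.
  set v := 1 + _ in vU.
  have y'E : y / v = y + p%:R ^+ s * (- (p%:R * t * y ^+ 2 / v)).
    apply: (mulIr vU); rewrite mulrDl !mulrN mulNr mulrA !mulrVK// mulrA.
    rewrite /v exprS; ring.
  exists (- (p%:R * t * y ^+ 2 / v)) => //=; rewrite -y'E.
  rewrite mulf_eq0 invr_eq0 (negbTE y0)/=.
  have v0 : v != 0 := padic_unit_neq0 vU.
  rewrite (negbTE v0); congr Some.
  rewrite (tofrac_div _ vU).
  have yF0 := tofrac_neq0 y0.
  have vF : v%:F = 1 + p%:R ^+ s.+1 * t%:F * y%:F.
    by rewrite /v tofrac_add !tofrac_mul tofracX_p tofrac_one.
  have vF0 := tofrac_neq0 v0.
  exact/esym/(inv_shift kappa beta yF0 vF0 vF).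
rewrite {1}/chart /= eqxx.
(* Neighbourhoods of oo are complements of closed compact sets, here [|z| <= p^s]; outside it,
   [y = 1 / z] is divisible by [p^s]. *)
exists [set beta + kappa / p%:R ^+ s * z%:F | z in [set: Zp]].
  split; first exact: padic_coset_compact.
  move=> x; rewrite /closure /= => xC.
  have g0 : kappa / p%:R ^+ s != 0.
    by apply: mulf_neq0 kappa0 _; rewrite invr_eq0; exact: expf_neq0.
  have [_ [[z _ <-] [z' _]]] := xC _ (nbhs_padic_coset x g0).
  move=> /(canRL (addrK _)) ->; exists (z - z') => //.
  rewrite tofrac_add tofrac_opp.
  exact: mul_sub_shift.
move=> x [[x' x'C <-]|->]; last first.
  by exists 0 => //; rewrite mulr0 addr0 /chart /= eqxx.
have pX0 k : p%:R ^+ k != 0 :> Qp := expf_neq0 k p0.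
have [[[] y']] := chart_surj (Some x'); rewrite /chart /=.
  move=> [x'E]; case: x'C; exists (p%:R ^+ s * (D * y')) => //.
  rewrite -x'E tofrac_mul tofracX_p addrC; congr (_ + _).
  exact: mul_div_cancel (pX0 s).
have [//|y'0 [x'E]] := eqVneq y' 0.
have [n [v vU y'E]] := padic_int_factor y'0.
have [sn|/ltnW ns] := leqP s n.
  exists (p%:R ^+ (n - s) * v) => //.
  by rewrite add0r mulrA -exprD subnKC// -y'E /chart /= (negbTE y'0) x'E.
case: x'C; exists (p%:R ^+ (s - n) / v) => //.
rewrite -x'E y'E (tofrac_div _ vU) tofrac_mul !tofracX_p addrC; congr (_ + _).
rewrite -{1}(subnK ns) exprD.
exact: inv_pow_split (pX0 _) (pX0 _) (padic_tofrac_neq0 vU).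
Qed.

End Chart.

(** * The Moebius map in the two charts *)

Section MobiusAlgebra.
Context (F : fieldType) (a b c d r D B Y : F).
Hypotheses (two0 : 2%:R != 0 :> F) (c0 : c != 0) (r0 : r != 0) (D0 : D != 0).
Hypothesis disc : (d - a) ^+ 2 + 4%:R * b * c = r ^+ 2 * D.
(** The fixed points of the map are [beta + kappa s] and [beta - kappa s] with [s^2 = D], so the
    coordinate [z] places them at [s] and [- s]. *)
Let kappa := r / (2%:R * c).
Let beta := (a - d) / (2%:R * c).

Lemma mobius_den z : c * (kappa * z + beta) + d = (r * z + (a + d)) / 2%:R.
Proof. by rewrite /kappa /beta; field; rewrite two0 c0. Qed.

(** In the coordinate [z] the map is multiplication of [z + s] by [(a + d) + r s]. *)
Lemma mobius_frac z : r * z + (a + d) != 0 ->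
  (a * (kappa * z + beta) + b) / (c * (kappa * z + beta) + d) =
  kappa * (((a + d) * z + r * D) / (r * z + (a + d))) + beta.
Proof.
move=> z0; rewrite mobius_den.
have four0 : 4%:R != 0 :> F by rewrite (natrM _ 2 2) mulf_neq0.
have -> : b = (r ^+ 2 * D - (d - a) ^+ 2) / (4%:R * c).
  by rewrite -disc; field; rewrite four0 c0.
by rewrite /kappa /beta; field; rewrite two0 c0 z0 four0.
Qed.

Lemma mobius_infty : a / c = kappa * ((a + d) / r) + beta.
Proof. by rewrite /kappa /beta; field; rewrite ?two0 ?c0 ?r0. Qed.

Section Fixing.
Hypothesis tE : (a + d) * B = r.

Lemma fixing_neq0 : B != 0.
Proof. by apply: contra_neq r0 => B0; rewrite -tE B0 mulr0. Qed.
Let B0 := fixing_neq0.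
Let tV : a + d = r / B. Proof. by rewrite -tE mulfK. Qed.

Lemma fixing_den_inv : Y != 0 -> r / Y + (a + d) = r * (Y + B) / (B * Y).
Proof. by move=> Y0; rewrite tV; field; rewrite Y0 B0. Qed.

Lemma fixing_den_mul : r * (D * Y) + (a + d) = r * (1 + D * B * Y) / B.
Proof. by rewrite tV; field; rewrite B0. Qed.

Lemma fixing_frac_inv : Y != 0 -> Y + B != 0 ->
  ((a + d) / Y + r * D) / (r / Y + (a + d)) = (1 + D * B * Y) / (Y + B).
Proof.
move=> Y0 YB0; rewrite tV; field; rewrite Y0 B0 YB0 /=.
by rewrite -mulrDr addrC mulf_neq0.
Qed.

Lemma fixing_frac_mul : 1 + D * B * Y != 0 ->
  ((a + d) * (D * Y) + r * D) / (r * (D * Y) + (a + d)) =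
  D * ((Y + B) / (1 + D * B * Y)).
Proof.
move=> Y0; rewrite tV; field; rewrite Y0 B0 /=.
rewrite (_ : _ + r = r * (1 + D * B * Y)); last by ring.
exact: mulf_neq0.
Qed.

Lemma fixing_infty : Y = 0 -> (a + d) / r = (1 + D * B * Y) / (Y + B).
Proof. by move=> ->; rewrite mulr0 addr0 add0r tV mulrAC divff. Qed.
End Fixing.

Section Swapping.
Hypothesis tE : a + d = r * D * B.

Lemma swapping_den_inv : Y != 0 -> r / Y + (a + d) = r * (1 + D * B * Y) / Y.
Proof. by move=> Y0; rewrite tE; field; rewrite Y0. Qed.

Lemma swapping_den_mul : r * (D * Y) + (a + d) = r * D * (Y + B).
Proof. by rewrite tE; ring. Qed.

Lemma swapping_frac_inv : Y != 0 -> 1 + D * B * Y != 0 ->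
  ((a + d) / Y + r * D) / (r / Y + (a + d)) = D * ((Y + B) / (1 + D * B * Y)).
Proof.
move=> Y0 Y1; rewrite tE; field; rewrite Y0 Y1 /=.
rewrite (_ : r + _ = r * (1 + D * B * Y)); last by ring.
exact: mulf_neq0.
Qed.

Lemma swapping_frac_mul : Y + B != 0 ->
  ((a + d) * (D * Y) + r * D) / (r * (D * Y) + (a + d)) =
  (1 + D * B * Y) / (Y + B).
Proof.
move=> Y0; rewrite tE; field; rewrite Y0 /=.
rewrite (_ : _ + _ = r * D * (Y + B)); last ring.
by rewrite !mulf_neq0.
Qed.

Lemma swapping_infty : Y = 0 -> (a + d) / r = D * ((Y + B) / (1 + D * B * Y)).
Proof. by move=> ->; rewrite mulr0 addr0 add0r divr1 tE; field. Qed.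
End Swapping.
End MobiusAlgebra.

Lemma mul_frac (F : fieldType) (k x y : F) : k * (x / y) = k / (y / x).
Proof. by rewrite invf_div. Qed.

Section MobiusDynamics.
Context (p : nat) (p_pr : prime p) (p_odd : odd p).
Local Notation Zp := (padic_int p_pr).
Local Notation Qp := (padic p_pr).
Local Notation "x %:F" := (@FracField.tofrac (padic_int p_pr) x : Qp).
Context (D u B : Zp) (a b c d r : Qp) (delta : bool).
Hypothesis uU : u \is a GRing.unit.
Hypothesis DE : D = p%:R * u.
Hypotheses (c0 : c != 0) (r0 : r != 0).
Hypothesis disc : (d - a) ^+ 2 + 4%:R * b * c = r ^+ 2 * D%:F.
Hypothesis tE : if delta then a + d = r * D%:F * B%:F else (a + d) * B%:F = r.

Lemma padic_two_neq0 : 2%:R != 0 :> Qp.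
Proof.
have -> : 2%:R = (2%:R : Zp)%:F :> Qp by rewrite rmorph_nat.
apply/padic_tofrac_neq0; rewrite padic_natU gtnNdvd//.
by case: (p) (prime_gt1 p_pr) p_odd => [|[|[|]]].
Qed.

Let kappa := r / (2%:R * c).
Let beta := (a - d) / (2%:R * c).
Let theta := chart D kappa beta.
Let two0 := padic_two_neq0.

Let kappa0 : kappa != 0 := mulf_neq0 r0 (invr_neq0 (mulf_neq0 two0 c0)).

Lemma mobius_Some z : mobius a b c d (Some (kappa * z + beta)) =
  if r * z + (a + d) == 0 then None else
  Some (kappa * (((a + d) * z + r * D%:F) / (r * z + (a + d))) + beta).
Proof.
rewrite /mobius (mobius_den a d r two0 c0).
have [z0|z0] := eqVneq (r * z + (a + d)) 0.
  by rewrite z0 mul0r eqxx.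
rewrite mulf_eq0 (negbTE z0) invr_eq0 (negbTE two0) /=; congr Some.
have := mobius_frac two0 c0 disc z0.
by rewrite (mobius_den a d r two0 c0).
Qed.

Lemma chartT y : theta (true, y) = Some (kappa * (D * y)%:F + beta).
Proof. by []. Qed.

Lemma chartF y :
  theta (false, y) = if y == 0 then None else Some (kappa / y%:F + beta).
Proof. by []. Qed.

(** Since [1 + D B y] is a unit, the image is oo only when it lies in the first chart and
    [y + B = 0]; for a finite argument the denominator of the map vanishes exactly then. The
    argument oo is treated apart. *)
Lemma mobius_chart (e : bool) (y : Zp) : mobius a b c d (theta (e, y)) =
  theta (e (+) delta, (y + B) / (1 + D * B * y)).
Proof.
have vU : 1 + D * B * y \is a GRing.unit.
  apply: padic_unitD (unitr1 _) _; rewrite -mulrA; apply: padic_dvdMr.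
  exact: chart_dvd DE.
set v := 1 + _ in vU *.
have v0 := padic_tofrac_neq0 vU.
have vE : v%:F = 1 + D%:F * B%:F * y%:F.
  by rewrite /v tofrac_add !tofrac_mul tofrac_one.
have yBE : (y + B)%:F = y%:F + B%:F := tofrac_add _ _.
have D0 : D%:F != 0 := tofrac_neq0 (chart_D0 uU DE).
have yvE : (D * ((y + B) / v))%:F = D%:F * ((y%:F + B%:F) / v%:F).
  by rewrite tofrac_mul (tofrac_div _ vU) yBE.
have yv0 : ((y + B) / v == 0) = (y%:F + B%:F == 0).
  rewrite mulf_eq0 invr_eq0 (negbTE (padic_unit_neq0 vU)) orbF.
  by rewrite -yBE tofrac_eq0.
have inf_to_inv : kappa * ((1 + D%:F * B%:F * y%:F) / (y%:F + B%:F)) =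
    kappa / ((y + B) / v)%:F.
  by rewrite (tofrac_div _ vU) yBE vE; exact: mul_frac.
rewrite vE in v0 yvE.
case: delta tE => tE'.
  case: e.
    rewrite chartT -[true (+) true]/false chartF.
    rewrite tofrac_mul mobius_Some (swapping_den_mul _ tE').
    rewrite mulf_eq0 (negbTE (mulf_neq0 r0 D0)) /= yv0.
    case: eqP => // /eqP yB0; congr (Some (_ + _)).
    rewrite -inf_to_inv; congr (_ * _); rewrite -(swapping_den_mul _ tE').
    exact: swapping_frac_mul r0 D0 tE' yB0.
  rewrite chartF -[false (+) true]/true chartT yvE.
  have [y0|y0] := eqVneq y 0.
    rewrite /mobius (negbTE c0) (mobius_infty a d two0 c0 r0).
    congr (Some (_ * _ + _)); apply: swapping_infty r0 tE' _.
    by rewrite y0; exact: tofrac_zero.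
  have Y0 := tofrac_neq0 y0.
  rewrite mobius_Some (swapping_den_inv tE' Y0).
  rewrite (negbTE (mulf_neq0 (mulf_neq0 r0 v0) (invr_neq0 Y0))).
  congr (Some (_ * _ + _)); rewrite -(swapping_den_inv tE' Y0).
  exact: swapping_frac_inv r0 tE' Y0 v0.
have B0 : B%:F != 0 := fixing_neq0 r0 tE'.
case: e.
  rewrite -[true (+) false]/true !chartT.
  rewrite yvE tofrac_mul mobius_Some (fixing_den_mul _ _ r0 tE').
  rewrite (negbTE (mulf_neq0 (mulf_neq0 r0 v0) (invr_neq0 B0))).
  congr (Some (_ * _ + _)); rewrite -(fixing_den_mul _ _ r0 tE').
  exact: fixing_frac_mul r0 tE' v0.
rewrite -[false (+) false]/false !chartF yv0; have [y0|y0] := eqVneq y 0.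
  have Y0 : y%:F = 0 by rewrite y0; exact: tofrac_zero.
  have YB : y%:F + B%:F != 0 by rewrite Y0 add0r.
  rewrite (negbTE YB) -inf_to_inv.
  rewrite /mobius (negbTE c0) (mobius_infty a d two0 c0 r0).
  by congr (Some (_ * _ + _)); exact: fixing_infty _ r0 tE' Y0.
have Y0 := tofrac_neq0 y0.
rewrite mobius_Some (fixing_den_inv r0 tE' Y0).
rewrite mulf_eq0 invr_eq0 (negbTE (mulf_neq0 B0 Y0)) orbF mulf_eq0 (negbTE r0) /=.
case: eqP => // /eqP yB0; rewrite -inf_to_inv.
congr (Some (_ * _ + _)); rewrite -(fixing_den_inv r0 tE' Y0).
exact: fixing_frac_inv _ r0 tE' Y0 yB0.
Qed.

Theorem mobius_decomposition (m : nat) (w : Zp) : w \is a GRing.unit ->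
  (coord_pow D 1 B p).2 = p%:R ^+ m * w ->
  exists2 E : 'I_((if delta then 1 else 2) * p ^ m.-1) -> set (padic_P1 p_pr),
    minimal_decomposition (mobius a b c d) E &
    forall i, conjugate_to_adding_machine (mobius a b c d) (E i)
      (fun s => if delta then (2 * p ^ s)%N else (p ^ s)%N).
Proof.
move=> wU BpE.
apply: (@translation_decomposition p p_pr p_odd D B w m delta (chart_dvd DE) wU
  BpE (padic_P1 p_pr) (mobius a b c d) theta (chartV D kappa beta)).
- exact: one_point_compactification_compact.
- exact: (chartK beta uU DE kappa0).
- exact: (chartVK beta uU DE kappa0).
- exact: mobius_chart.
move=> s x; have xE := chartVK beta uU DE kappa0 x.
rewrite -{1}xE; apply: filterS (nbhs_chart beta uU DE kappa0 s _).
move=> _ [t _ <-] /=; rewrite (chartK beta uU DE kappa0) /=; split=> //.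
by exists t; rewrite addrC addKr.
Qed.

End MobiusDynamics.

(** * Absolute values on the quadratic extension *)

Section PadicSquareRoot.
Context (p : nat) (p_pr : prime p) (p_odd : odd p).
Local Notation Zp := (padic_int p_pr).
Implicit Types x y v : Zp.

Lemma expr1D_expansion x n :
  exists t : Zp, (1 + x) ^+ n = 1 + n%:R * x + x ^+ 2 * t.
Proof.
elim: n => [|n [t tE]]; first by exists 0; rewrite mul0r mulr0 !addr0.
exists (n%:R + t + x * t); rewrite exprS tE -natr1; ring.
Qed.

Lemma padic_dvd_expr_p v s : padic_dvd 1 (v - 1) ->
  padic_dvd s.+1 (v ^+ (p ^ s) - 1).
Proof.
move=> v1; elim: s => [|s [z zE]]; first by rewrite expr1.
have -> : v ^+ (p ^ s.+1) = (1 + p%:R ^+ s.+1 * z) ^+ p.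
  by rewrite -zE addrC subrK -exprM expnSr.
have [t ->] := expr1D_expansion (p%:R ^+ s.+1 * z) p.
exists (z + p%:R ^+ s * z ^+ 2 * t); rewrite !exprS; ring.
Qed.

Lemma padic_dvd_expr v s n : padic_dvd s (v - 1) -> padic_dvd s (v ^+ n - 1).
Proof.
by move=> vs; rewrite subrX1; exact: padic_dvdMr.
Qed.

(* The square root of [v] is the limit of [v ^ ((p ^ s + 1) / 2)], since
   [v ^ (p ^ s)] tends to [1]. *)
Lemma padic_square v : padic_dvd 1 (v - 1) -> exists x, x ^+ 2 = v.
Proof.
move=> v1; pose h s := ((p ^ s).+1)./2.
have h2 s : (h s * 2 = (p ^ s).+1)%N.
  by rewrite muln2 halfK /= oddX p_odd orbT /= subn0.
have vp s : padic_dvd s (v ^+ (p ^ s) - 1).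
  have [z ->] := padic_dvd_expr_p s v1.
  by exists (p%:R * z); rewrite mulrA exprSr.
(* Consecutive approximations differ by a power of [v^(p^s)], which is 1 modulo [p^s]. *)
have hS s : h s.+1 = (h s + p ^ s * p./2)%N.
  apply/eqP; rewrite -(eqn_pmul2r (ltn0Sn 1)) mulnDl !h2 -mulnA.
  have pE : (p./2 * 2).+1 = p by rewrite muln2 -[RHS]odd_double_half p_odd.
  by rewrite expnSr -[X in (_ * X).+1]pE mulnS addSn.
have fP s : (padic_res (v ^+ h s.+1) s.+1 =
    padic_res (v ^+ h s) s %[mod p ^ s])%N.
  rewrite padic_resS padic_res_mod; apply/padic_res_eq.
  rewrite hS exprD -{2}[v ^+ h s]mulr1 -mulrBr exprM; apply: padic_dvdMl.
  exact: padic_dvd_expr.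
exists (padic_of p_pr fP); apply/padic_intP => s.
rewrite expr2 padic_resM !padic_ofE !padic_res_mod -padic_resM -expr2 -exprM h2.
apply/padic_res_eq; rewrite exprS -[X in _ - X]mulr1 -mulrBr.
exact: padic_dvdMl.
Qed.
End PadicSquareRoot.

Lemma coord_pow_root (p : nat) (p_pr : prime p) (D B : padic_int p_pr)
    (K : comPzRingType) (f : padic_int p_pr -> K) (s : K) n :
  f 0 = 0 -> f 1 = 1 -> {morph f : x y / x + y} -> {morph f : x y / x * y} ->
  s ^+ 2 = f D ->
  (1 + f B * s) ^+ n = f (coord_pow D 1 B n).1 + f (coord_pow D 1 B n).2 * s.
Proof.
move=> f0 f1 fD fM sE; elim: n => [|n IHn] /=.
  by rewrite f0 f1 mul0r addr0.
rewrite exprSr IHn !fD !fM f1 -sE; ring.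
Qed.

(** Conjugation [s -> - s]; it gives the powers of the denominator [1 - B s] of [mu]. *)
Lemma coord_pow_opp (p : nat) (p_pr : prime p) (D B : padic_int p_pr) n :
  coord_pow D 1 (- B) n = ((coord_pow D 1 B n).1, - (coord_pow D 1 B n).2).
Proof.
elim: n => [|n IHn] /=; first by rewrite oppr0.
by rewrite -/(coord_pow D 1 (- B) n) IHn /=; congr pair; ring.
Qed.

Section AbsoluteValue.
Context (R : realType) (p : nat) (p_pr : prime p).
Context (K : fieldExtType (padic p_pr)) (absK : K -> R).
Hypothesis absKP : extends_padic_abs absK.
Implicit Types x y z : K.
Local Notation Zp := (padic_int p_pr).
Local Notation Qp := (padic p_pr).
Local Notation "x %:F" := (@FracField.tofrac (padic_int p_pr) x : Qp).

Let absM := extends_padic_absM absKP.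
Let absD := extends_padic_absD absKP.
Let abs0 := extends_padic_abs_eq0 absKP.
Let abs_ge0 := extends_padic_abs_ge0 absKP.
Let absA := extends_padic_abs_base absKP.

Lemma absK_zero : absK 0 = 0.
Proof. by rewrite -(scale0r (1 : K)) absA padic_abs0. Qed.

Lemma absK_one : absK 1 = 1.
Proof.
rewrite -(scale1r (1 : K)) absA.
have := @padic_absE _ p_pr R 0 1 (unitr1 _).
rewrite expr0z mul1r oppr0 expr0z -[RHS]/1 => <-.
by congr padic_abs; rewrite rmorph1.
Qed.

Lemma absK_opp x : absK (- x) = absK x.
Proof.
have N1 : absK (-1) = 1.
  by rewrite -[-1]scaleN1r absA padic_absN -absA scale1r absK_one.
by rewrite -mulN1r absM N1 mul1r.
Qed.

Lemma absK_gt0 x : x != 0 -> 0 < absK x.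
Proof.
move=> x0; rewrite lt_def abs_ge0 andbT.
by apply: contra_neq x0 => /abs0.
Qed.

Lemma absK_inv x : absK x^-1 = (absK x)^-1.
Proof.
have [->|x0] := eqVneq x 0; first by rewrite invr0 absK_zero invr0.
apply: (mulIf (lt0r_neq0 (absK_gt0 x0))).
by rewrite -absM !mulVf ?absK_one// lt0r_neq0// absK_gt0.
Qed.

Lemma absK_exp x n : absK (x ^+ n) = absK x ^+ n.
Proof.
by elim: n => [|n IHn]; rewrite ?absK_one// !exprS absM IHn.
Qed.

Lemma absK_lt_add x y : absK x < absK y -> absK (x + y) = absK y.
Proof.
move=> xy; apply/eqP; rewrite eq_le; apply/andP; split.
  by rewrite (le_trans (absD x y))// ge_max lexx ltW.
rewrite leNgt; apply/negP => xyy.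
have := absD (x + y) (- x); rewrite absK_opp addrAC subrr add0r leNgt => /negP.
by apply; rewrite gt_max xyy.
Qed.

Lemma absK_add_neq x y : absK x != absK y ->
  absK (x + y) = Num.max (absK x) (absK y).
Proof.
case: ltgtP => // xy _; first exact: absK_lt_add.
by rewrite addrC; exact: absK_lt_add.
Qed.

Lemma absK_padic (n : int) (u : Zp) : u \is a GRing.unit ->
  absK (p%:R ^ n * u%:F)%:A = p%:R ^ (- n).
Proof. by move=> uU; rewrite absA padic_absE. Qed.

Lemma absK_int_le1 (u : Zp) : absK (u%:F)%:A <= 1.
Proof. by rewrite absA; apply/(padic_abs_le1 R); exists u. Qed.

Lemma vp_pow z (k : int) : absK z = p%:R ^ (- k) -> vp absK z = k%:~R.
Proof.
have p1 : 1 < p%:R :> R by rewrite ltr1n prime_gt1.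
rewrite /vp => ->; rewrite -powR_intmul; last by rewrite ltW// (lt_trans ltr01).
rewrite ln_powR mulfK ?opprK ?lt0r_neq0 ?ln_gt0//.
by rewrite mulrNz opprK.
Qed.

Lemma vp_mul x y : x != 0 -> y != 0 -> vp absK (x * y) = vp absK x + vp absK y.
Proof.
move=> x0 y0; rewrite /vp absM lnM ?posrE ?absK_gt0// mulrDl opprD.
by [].
Qed.
End AbsoluteValue.

Section Scalars.
Context (F : fieldType) (K : fieldExtType F).
Implicit Types x y : F.

Lemma scalarD x y : (x + y)%:A = x%:A + y%:A :> K.
Proof. exact: scalerDl. Qed.

Lemma scalarN x : (- x)%:A = - x%:A :> K.
Proof. exact: scaleNr. Qed.

Lemma scalarM x y : (x * y)%:A = x%:A * y%:A :> K.
Proof. by rewrite mulr_algl scalerA. Qed.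

Lemma scalarX x n : (x ^+ n)%:A = x%:A ^+ n :> K.
Proof. exact: (rmorphXn (in_alg K)). Qed.

Lemma scalar_eq0 x : (x%:A == 0 :> K) = (x == 0).
Proof. exact: (fmorph_eq0 (in_alg K)). Qed.
End Scalars.

(** * Value groups of quadratic extensions *)

Section QuadraticExtension.
Context (F : fieldType) (K : fieldExtType F) (s : K).
Hypothesis s_notin : s \notin 1%VS.

Lemma scalar_in1 (x : F) : x%:A \in (1%VS : {vspace K}).
Proof. by apply/vlineP; exists x. Qed.

Lemma not_scalar (x : F) : s <> x%:A.
Proof. by move=> sE; move: s_notin; rewrite sE scalar_in1. Qed.

Lemma sqr_not_scalar (x : F) : s ^+ 2 <> (x ^+ 2)%:A.
Proof.
move=> /eqP; rewrite -[(x ^+ 2)%:A]/(in_alg K (x ^+ 2)) rmorphXn /= eqf_sqr.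
move=> /orP[/eqP/not_scalar//|/eqP sE].
by apply: (@not_scalar (- x)); rewrite scaleNr.
Qed.

Lemma quadratic_coord : \dim {:K} = 2%N ->
  forall z : K, exists x y : F, z = x%:A + y *: s.
Proof.
move=> dimK z; pose U := (1 + <[s]>)%VS.
have sU : s \in U by rewrite -[s]add0r memv_add ?mem0v// memv_line.
have UE : U = fullv.
  apply/eqP; rewrite eqEdim subvf dimK /= ltnNge; apply/negP => dU.
  have /eqP U1 : (1%VS == U :> {vspace K}) by rewrite eqEdim addvSl dimv1.
  by rewrite -U1 (negbTE s_notin) in sU.
have : z \in U by rewrite UE memvf.
case/memv_addP => _ /vlineP[x ->] [_ /vlineP[y ->] ->].
by exists x, y.
Qed.
End QuadraticExtension.

Section QuadraticValues.
Context (R : realType) (p : nat) (p_pr : prime p) (p_odd : odd p).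
Context (K : fieldExtType (padic p_pr)) (absK : K -> R).
Hypothesis absKP : extends_padic_abs absK.
Hypothesis dimK : \dim {:K} = 2%N.
Context (s : K).
Hypothesis s_notin : s \notin 1%VS.
Local Notation Zp := (padic_int p_pr).
Local Notation Qp := (padic p_pr).
Local Notation "x %:F" := (@FracField.tofrac (padic_int p_pr) x : Qp).

Let absM := extends_padic_absM absKP.
Let absD := extends_padic_absD absKP.
Let abs_ge0 := extends_padic_abs_ge0 absKP.
Let absA := extends_padic_abs_base absKP.

Let p0 : 0 < p%:R :> R. Proof. by rewrite ltr0n prime_gt0. Qed.
Let p1 : 1 < p%:R :> R. Proof. by rewrite ltr1n prime_gt1. Qed.

Lemma absK_scalar (x : Qp) : x != 0 ->
  exists k : int, absK x%:A = p%:R ^ (- k).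
Proof.
by move=> /padic_factor[k [u uU ->]]; exists k; exact: absK_padic.
Qed.

Lemma absK_scalar_lt1 (u : Zp) : absK (u%:F)%:A < 1 <-> padic_dvd 1 u.
Proof.
split=> [u1|[z ->]].
  apply/padic_dvd1U; apply: contraTN u1 => uU.
  have := absK_padic absKP 0 uU.
  by rewrite expr0z mul1r oppr0 expr0z => ->; rewrite ltxx.
rewrite tofrac_mul scalarM absM tofracX_p expr1.
have -> : absK (p%:R)%:A = p%:R^-1.
  have := absK_padic absKP 1 (unitr1 _).
  by rewrite tofrac_one expr1z mulr1.
apply: (@le_lt_trans _ _ (p%:R^-1)); last by rewrite invf_lt1.
by apply: ler_piMr; [rewrite invr_ge0 ltW|exact: absK_int_le1].
Qed.

(** All reduces to [|x + s| = max(|x|, 1)]: a smaller value would make [v] a square modulo p, hence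
    a square in [Q_p] by [padic_square], although [s] is not in [Q_p]. *)
Lemma unramified_abs (v : Zp) : v \is a GRing.unit -> s ^+ 2 = (v%:F)%:A ->
  forall z, z != 0 -> exists k : int, absK z = p%:R ^ (- k).
Proof.
move=> vU sE.
have abs_s : absK s = 1.
  have : absK s ^+ 2 = 1.
    rewrite -(absK_exp absKP) sE.
    by have := absK_padic absKP 0 vU; rewrite expr0z mul1r oppr0 expr0z.
  by move=> /eqP; rewrite sqrp_eq1// => /eqP.
have key (x : Qp) : absK (x%:A + s) = Num.max (absK x%:A) 1.
  have [x1|x1] := eqVneq (absK x%:A) (absK s); last first.
    by rewrite absK_add_neq// abs_s.
  rewrite x1 abs_s maxxx; apply/eqP; rewrite eq_le; apply/andP; split.
    by have := absD x%:A s; rewrite x1 abs_s maxxx.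
  rewrite leNgt; apply/negP => xs1.
  have [w wE] : exists w, x = w%:F.
    by apply/(padic_abs_le1 R); rewrite -absA x1 abs_s.
  have wU : w \is a GRing.unit.
    apply/negPn/negP => /padic_dvd1U/absK_scalar_lt1.
    by rewrite -wE x1 abs_s ltxx.
  have vw : padic_dvd 1 (w ^+ 2 - v).
    apply/absK_scalar_lt1.
    have -> : ((w ^+ 2 - v)%:F)%:A = (x%:A + s) * (x%:A - s) :> K.
      rewrite mulrC -subr_sqr sE tofrac_add tofrac_opp expr2 tofrac_mul -wE.
      by rewrite scalarD scalarN scalarM -expr2.
    rewrite absM; apply: le_lt_trans xs1; apply: ler_piMr; first exact: abs_ge0.
    by have := absD x%:A (- s); rewrite absK_opp// x1 abs_s maxxx.
  have w2U : w ^+ 2 \is a GRing.unit by rewrite unitrX.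
  have [y yE] : exists y, y ^+ 2 = v / w ^+ 2.
    apply: padic_square => //; apply/(padic_dvdMU _ _ w2U).
    rewrite mulrBl divrK// mul1r -opprB -mulN1r.
    exact: padic_dvdMl.
  apply: (@sqr_not_scalar _ _ _ s_notin (y * w)%:F).
  rewrite sE; congr (_ %:A).
  by rewrite expr2 -tofrac_mul -expr2 exprMn yE divrK.
move=> z z0; have [x [y zE]] := quadratic_coord s_notin dimK z.
have [y0|y0] := eqVneq y 0.
  move: z0; rewrite zE y0 scale0r addr0 => z0; apply: absK_scalar.
  by apply: contra_neq z0 => ->; rewrite scale0r.
have zE' : z = y%:A * ((x / y)%:A + s).
  by rewrite mulrDr -scalarM mulrC mulr_algl zE divfK.
have [k kE] := absK_scalar y0.
rewrite zE' absM key kE.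
have [xy0|/absK_scalar[k' k'E]] := eqVneq (x / y) 0.
  exists k; rewrite xy0 scale0r absK_zero// max_r// mulr1//.
case: (leP (absK (x / y)%:A) 1) => xy.
  by exists k; rewrite mulr1.
exists (k + k'); rewrite k'E opprD expfzDr//; exact: lt0r_neq0.
Qed.

End QuadraticValues.

Section RamifiedValues.
Context (R : realType) (p : nat) (p_pr : prime p).
Context (K : fieldExtType (padic p_pr)) (absK : K -> R).
Hypothesis absKP : extends_padic_abs absK.
Local Notation Zp := (padic_int p_pr).
Local Notation Qp := (padic p_pr).
Local Notation "x %:F" := (@FracField.tofrac (padic_int p_pr) x : Qp).

Let absM := extends_padic_absM absKP.
Let absD := extends_padic_absD absKP.
Let abs_ge0 := extends_padic_abs_ge0 absKP.
Let p0 : 0 < p%:R :> R. Proof. by rewrite ltr0n prime_gt0. Qed.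
Let p1 : 1 < p%:R :> R. Proof. by rewrite ltr1n prime_gt1. Qed.
Let pn0 : p%:R != 0 :> R. Proof. exact: lt0r_neq0. Qed.

(** Since [|s|] will be [p^(-1/2)], squares of absolute values are used to keep integer
    exponents. *)
Lemma double_vp z (i : int) : absK z ^+ 2 = p%:R ^ (- i) ->
  2%:R * vp absK z = i%:~R.
Proof.
move=> zi; have z0 : z != 0.
  apply: contra_eq_neq zi => ->; rewrite absK_zero// expr0n /= eq_sym.
  by rewrite expfz_neq0.
by rewrite mulr_natl mulr2n -vp_mul//; apply: vp_pow; rewrite absM -expr2.
Qed.

Lemma inv_ramification_index e : ramification_index absK e ->
  exists2 z, z != 0 & vp absK z = e%:R^-1.
Proof.
move=> [_ vE]; have : [set k%:~R / e%:R | k in [set: int]] (e%:R^-1 : R).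
  by exists 1 => //; rewrite mul1r.
by rewrite -vE => -[z z0 zE]; exists z.
Qed.

(** [1 / e] is a value of [vp], hence an integer. *)
Lemma unramified_index e : ramification_index absK e ->
  (forall z, z != 0 -> exists k : int, absK z = p%:R ^ (- k)) -> e = 1%N.
Proof.
move=> eP H; have [z z0 zE] := inv_ramification_index eP.
have e0 : e%:R != 0 :> R by rewrite pnatr_eq0 -lt0n; case: eP.
have [k /vp_pow] := H z z0; rewrite zE => kE.
have : (k * e%:Z)%:~R = 1%:~R :> R by rewrite intrM -kE mulVf.
move=> /intr_inj/(congr1 absz); rewrite abszM /= => /eqP.
by rewrite muln_eq1 => /andP[_ /eqP].
Qed.

Lemma scalar_sqr_abs_neq (x : Qp) (j : int) :
  absK x%:A ^+ 2 != p%:R ^ (- (2 * j + 1)).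
Proof.
have [->|x0] := eqVneq x 0.
  by rewrite scale0r absK_zero// expr0n /= eq_sym expfz_neq0.
have [k ->] := absK_scalar absKP x0.
rewrite exprnP exprz_exp; apply/eqP => /(ieexprIz p0 (negbT (gt_eqF p1))).
lia.
Qed.

Section RamifiedGenerator.
Context (s : K) (D u : Zp).
Hypothesis uU : u \is a GRing.unit.
Hypothesis DE : D = p%:R * u.
Hypothesis sE : s ^+ 2 = (D%:F)%:A.

Lemma absK_generator : absK s ^+ 2 = p%:R ^ (- 1).
Proof.
rewrite -absK_exp// sE DE tofrac_mul.
have <- : p%:R ^ 1 = (p%:R : Zp)%:F by rewrite expr1z rmorph_nat.
exact: absK_padic.
Qed.

Lemma absK_generator_lt1 : absK s < 1.
Proof.
rewrite ltNge; apply/negP => s1.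
have : 1 <= absK s ^+ 2 by rewrite exprn_ege1.
by rewrite absK_generator leNgt exprN1 invf_lt1// p1.
Qed.

(** For nonzero [x] and [y], [|x|^2] is an even and [|y s|^2] an odd power of p, so the larger one
    decides. *)
Lemma ramified_abs : s \notin 1%VS -> \dim {:K} = 2%N ->
  forall z, z != 0 -> exists i : int, absK z ^+ 2 = p%:R ^ (- i).
Proof.
move=> s1 dimK z z0; have [x [y zE]] := quadratic_coord s1 dimK z.
have sqr_abs (v : Qp) : v != 0 -> exists j : int,
    absK v%:A ^+ 2 = p%:R ^ (- (2 * j)).
  move=> /(absK_scalar absKP)[j ->]; exists j.
  by rewrite exprnP exprz_exp mulNr mulrC.
have sqr_abs_s (v : Qp) : v != 0 -> exists j : int,
    absK (v *: s) ^+ 2 = p%:R ^ (- (2 * j + 1)).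
  move=> /sqr_abs[j jE]; exists j.
  by rewrite -mulr_algl absM exprMn jE absK_generator -expfzDr// opprD.
have [y0|/sqr_abs_s[j jE]] := eqVneq y 0.
  have x0 : x != 0.
    by apply: contra_neq z0 => x0; rewrite zE x0 y0 !scale0r addr0.
  have [j jE] := sqr_abs x x0; exists (2 * j).
  by rewrite zE y0 scale0r addr0.
have xy : absK x%:A != absK (y *: s).
  apply/eqP => xy; have := scalar_sqr_abs_neq x j.
  by rewrite xy jE eqxx.
rewrite zE absK_add_neq//.
have [xy1|xy1] := leP (absK x%:A) (absK (y *: s)); first by exists (2 * j + 1).
have x0 : x != 0.
  apply: contraTneq xy1 => ->; rewrite scale0r absK_zero// ltNge abs_ge0//.
by have [i iE] := sqr_abs x x0; exists (2 * i).
Qed.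

(** [2 vp] takes integer values, among them [2 / e]. *)
Lemma ramified_index e : s \notin 1%VS -> \dim {:K} = 2%N ->
  ramification_index absK e -> (1 < e)%N -> e = 2%N.
Proof.
move=> s1 dimK eP e1; have [z z0 zE] := inv_ramification_index eP.
have e0 : e%:R != 0 :> R by rewrite pnatr_eq0 -lt0n; case: eP.
have [i /double_vp] := ramified_abs s1 dimK z0; rewrite zE => iE.
have : (i * e%:Z)%:~R = 2%:~R :> R by rewrite intrM -iE divfK.
move=> /intr_inj/(congr1 absz); rewrite abszM /= => ie.
have := dvdn_mull `|i| (dvdnn e); rewrite ie => /(dvdn_leq (ltn0Sn 1)).
by case: (e) e1 => [|[|[|]]].
Qed.

Context (B : Zp).
Local Notation C := (coord_pow D 1 B p).2.
Local Notation A := (coord_pow D 1 B p).1.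
Local Notation mu := ((1 + (B%:F)%:A * s) / (1 - (B%:F)%:A * s)).

Lemma absK_int_generator (x : Zp) : absK ((x%:F)%:A * s) < 1.
Proof.
rewrite absM; apply: le_lt_trans absK_generator_lt1.
by rewrite mulrC; apply: ler_piMr => //; exact: absK_int_le1.
Qed.

Lemma absK_unit_sub (v x : Zp) : v \is a GRing.unit ->
  absK ((v%:F)%:A - (x%:F)%:A * s) = 1.
Proof.
move=> vU; have v1 : absK (v%:F)%:A = 1.
  by have := absK_padic absKP 0 vU; rewrite expr0z mul1r oppr0 expr0z.
by rewrite addrC absK_lt_add ?v1// absK_opp// absK_int_generator.
Qed.

Lemma cayley_sub1 (F : fieldType) (x y : F) : x - y != 0 ->
  (x + y) / (x - y) - 1 = (y + y) / (x - y).
Proof. by move=> xy; field. Qed.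

Hypothesis p_odd : odd p.

Lemma absK_two (x : K) : absK (x + x) = absK x.
Proof.
have U2 : (2%:R : Zp) \is a GRing.unit.
  rewrite padic_natU gtnNdvd//.
  by case: (p) (prime_gt1 p_pr) p_odd => [|[|[|]]].
have : absK (((2%:R : Zp)%:F)%:A) = 1.
  by have := absK_padic absKP 0 U2; rewrite expr0z mul1r oppr0 expr0z.
have -> : (2%:R : Zp)%:F = 2%:R :> Qp by rewrite rmorph_nat.
by rewrite scaler_nat => h; rewrite -mulr2n -mulr_natl absM h mul1r.
Qed.

Lemma cayley_pow :
  mu ^+ p = ((A%:F)%:A + (C%:F)%:A * s) / ((A%:F)%:A - (C%:F)%:A * s).
Proof.
pose f (x : Zp) : K := (x%:F)%:A.
have f0 : f 0 = 0 by rewrite /f tofrac_zero scale0r.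
have f1 : f 1 = 1 by rewrite /f tofrac_one scale1r.
have fD : {morph f : x y / x + y}.
  by move=> x y; rewrite /f tofrac_add scalarD.
have fM : {morph f : x y / x * y}.
  by move=> x y; rewrite /f tofrac_mul scalarM.
have fN x : f (- x) = - f x by rewrite /f tofrac_opp scalarN.
have e1 := coord_pow_root B p f0 f1 fD fM sE.
have := coord_pow_root (- B) p f0 f1 fD fM sE.
rewrite coord_pow_opp /= !fN !mulNr => e2.
by rewrite exprMn exprVn -/(f B) e1 e2.
Qed.

Lemma absK_cayley_sub1_lt1 : absK (mu - 1) < 1.
Proof.
have dU : absK (1 - (B%:F)%:A * s) = 1.
  have := absK_unit_sub B (unitr1 _).
  by rewrite tofrac_one scale1r.
rewrite cayley_sub1; last first.
  by apply: contra_eq_neq dU => ->; rewrite absK_zero// eq_sym oner_eq0.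
by rewrite absM absK_inv// dU invr1 mulr1 absK_two absK_int_generator.
Qed.

(** [mu^p - 1 = 2 C s / (A - C s)], where 2 and the denominator have absolute value 1 and
    [|C s|^2 = p^(-2m-1)]. *)
Lemma double_vp_cayley_pow m w : w \is a GRing.unit -> C = p%:R ^+ m * w ->
  2%:R * vp absK (mu ^+ p - 1) = (m.*2.+1)%:R.
Proof.
move=> wU CE.
have AU : A \is a GRing.unit by apply: coord_pow1_unit; exact: chart_dvd DE.
have dU := absK_unit_sub C AU.
have d0 : (A%:F)%:A - (C%:F)%:A * s != 0.
  by apply: contra_eq_neq dU => ->; rewrite absK_zero// eq_sym oner_eq0.
rewrite (@double_vp _ (m.*2.+1)%:Z) ?mulrz_nat//.
rewrite cayley_pow cayley_sub1// absM absK_inv// dU invr1 mulr1 absK_two.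
rewrite absM exprMn absK_generator CE tofrac_mul tofracX_p.
have -> : absK (p%:R ^+ m * w%:F)%:A = p%:R ^ (- m%:Z) by exact: absK_padic.
rewrite exprnP exprz_exp -expfzDr//; congr (_ ^ _); lia.
Qed.

End RamifiedGenerator.
End RamifiedValues.

Lemma cayley_scale (F : fieldType) (t r s B : F) : t != 0 -> t * B = r ->
  (t + r * s) / (t - r * s) = (1 + B * s) / (1 - B * s).
Proof.
move=> t0 <-; have -> : t + t * B * s = t * (1 + B * s) by ring.
have -> : t - t * B * s = t * (1 - B * s) by ring.
by rewrite invfM mulrACA divff// mul1r.
Qed.

(** Here [t + r s = r s (1 + B s)]; conjugation changes the sign of the factor [r s], whence the
    minus sign. *)
Lemma cayley_swap (F : fieldType) (t r s D B : F) : r != 0 -> s != 0 ->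
  s ^+ 2 = D -> t = r * D * B ->
  (t + r * s) / (t - r * s) = - ((1 + B * s) / (1 - B * s)).
Proof.
move=> r0 s0 <- ->.
have -> : r * s ^+ 2 * B + r * s = r * s * (1 + B * s) by ring.
have -> : r * s ^+ 2 * B - r * s = r * s * - (1 - B * s) by ring.
by rewrite invfM mulrACA divff ?mulf_neq0// mul1r invrN mulrN.
Qed.

(** * The count in terms of lambda *)

Section RamifiedMobius.
Context (R : realType) (p : nat) (p_pr : prime p) (p_odd : odd p).
Context (K : fieldExtType (padic p_pr)) (absK : K -> R).
Hypothesis absKP : extends_padic_abs absK.
Hypothesis dimK : \dim {:K} = 2%N.
Context (e : nat) (eP : ramification_index absK e) (e_gt1 : (1 < e)%N).
Local Notation Zp := (padic_int p_pr).
Local Notation Qp := (padic p_pr).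
Local Notation "x %:F" := (@FracField.tofrac (padic_int p_pr) x : Qp).

Lemma scalar_rescale (s : K) (r x : Qp) : r != 0 -> s \notin 1%VS ->
  s ^+ 2 = (r ^+ 2 * x)%:A ->
  exists s' : K, [/\ s = r%:A * s', s' ^+ 2 = x%:A & s' \notin 1%VS].
Proof.
move=> r0 s1 sE; have rA0 : r%:A != 0 :> K by rewrite scalar_eq0.
exists (s / r%:A); split.
- by rewrite mulrCA divff// mulr1.
- by rewrite expr_div_n sE scalarM scalarX mulrAC divff ?mul1r// expf_neq0.
- apply: contra s1 => /vlineP[y yE]; rewrite -(divfK rA0 s) yE -scalarM.
  exact: scalar_in1.
Qed.

Lemma ramified_discriminant (s : K) (x : Qp) : s \notin 1%VS ->
  s ^+ 2 = x%:A -> exists (k : int) (u : Zp),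
  u \is a GRing.unit /\ x = (p%:R ^ k) ^+ 2 * (p%:R * u : Zp)%:F.
Proof.
move=> s1 sE; have x0 : x != 0.
  apply/eqP => x0; apply: (@sqr_not_scalar _ _ _ s1 0).
  by rewrite sE x0 expr0n.
have pp0 := padic_p_neq0 p_pr.
have [n [u uU xE]] := padic_factor x0.
have [k [nE|nE]] : exists k : int, n = k * 2 \/ n = k * 2 + 1.
  by exists (n %/ 2)%Z; lia.
(* For even valuation, rescaling yields a generator whose square is a unit, which forces [e = 1]. *)
- move: sE; rewrite xE nE -exprz_exp => sE.
  have [s' [_ s'E s'1]] := scalar_rescale (expfz_neq0 k pp0) s1 sE.
  have := unramified_index eP (unramified_abs p_odd absKP dimK s'1 uU s'E).
  by move=> e1; move: e_gt1; rewrite e1.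
exists k, u; split=> //.
rewrite xE nE expfzDr// expr1z -exprz_exp tofrac_mul mulrA; congr (_ * _ * _).
by rewrite rmorph_nat.
Qed.

Section Core.
Context (s lambda : K) (a b c d r : Qp) (D u B : Zp) (delta : bool).
Hypothesis uU : u \is a GRing.unit.
Hypothesis DE : D = p%:R * u.
Hypothesis r0 : r != 0.
Hypothesis c0 : c != 0.
Hypothesis disc : (d - a) ^+ 2 + 4%:R * b * c = r ^+ 2 * D%:F.
Hypothesis tE : if delta then a + d = r * D%:F * B%:F else (a + d) * B%:F = r.
Hypothesis sE : s ^+ 2 = (D%:F)%:A.
Hypothesis s1 : s \notin 1%VS.
Hypothesis lambdaE :
  lambda = ((a + d)%:A + r%:A * s) / ((a + d)%:A - r%:A * s).
Hypothesis lambda_not_root : forall n : nat, (0 < n)%N -> lambda ^+ n <> 1.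

Local Notation mu := ((1 + (B%:F)%:A * s) / (1 - (B%:F)%:A * s)).
(** As p is odd, [lambda = eps mu] gives [lambda^p - eps = eps (mu^p - 1)], so both cases reduce to
    [mu]. *)
Let eps : K := if delta then -1 else 1.

Let lambda_mu : lambda = eps * mu.
Proof.
have s0 : s != 0.
  by apply: contraNneq s1 => ->; rewrite mem0v.
have rA0 : r%:A != 0 :> K by rewrite scalar_eq0; exact: r0.
rewrite lambdaE /eps; case: delta tE => tE'.
  rewrite mulN1r; apply: (cayley_swap rA0 s0 sE).
  by rewrite tE' !scalarM.
rewrite mul1r; apply: cayley_scale; last by rewrite -tE' scalarM.
rewrite scalar_eq0; apply: contra_neq r0 => t0.
by rewrite -tE' t0 mul0r.
Qed.

Let eps_p : eps ^+ p = eps.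
Proof. by rewrite /eps; case: delta; rewrite ?expr1n// -signr_odd p_odd expr1. Qed.

Let abs_eps x : absK (eps * x) = absK x.
Proof. by rewrite /eps; case: delta; rewrite ?mul1r// mulN1r absK_opp. Qed.

Lemma lambda_sub_lt1 : absK (lambda - eps) < 1.
Proof.
rewrite lambda_mu -{2}[eps]mulr1 -mulrBr abs_eps.
exact (absK_cayley_sub1_lt1 absKP uU DE sE B p_odd).
Qed.

Lemma ramified_mobius_decomposition :
  exists (M : nat) (E : 'I_M -> set (padic_P1 p_pr)),
  [/\ M%:R = (if delta then 1 else 2%:R) *
        p%:R `^ ((v_unif absK e (lambda ^+ p - eps) - 3%:R) / 2%:R) :> R,
      minimal_decomposition (mobius a b c d) E &
      forall i, conjugate_to_adding_machine (mobius a b c d) (E i)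
        (fun s => if delta then (2 * p ^ s)%N else (p ^ s)%N)].
Proof.
(* [B_p = 0] would give [mu^p = 1], hence [lambda^(2p) = 1]; the exponent is doubled because [eps]
   may be -1. *)
have C0 : (coord_pow D 1 B p).2 != 0.
  apply/eqP => C0; apply: (lambda_not_root (n := p * 2)).
    by rewrite muln_gt0 prime_gt0.
  have AU : (coord_pow D 1 B p).1 \is a GRing.unit.
    by apply: coord_pow1_unit; exact: chart_dvd DE.
  rewrite lambda_mu exprMn exprM eps_p.
  have -> : eps ^+ 2 = 1 by rewrite /eps; case: delta; rewrite ?sqrrN expr1n.
  rewrite exprM (cayley_pow sE B) C0 tofrac_zero scale0r mul0r.
  rewrite addr0 subr0 divff ?expr1n ?mulr1// scalar_eq0.
  exact: padic_tofrac_neq0.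
have [m [w wU CE]] := padic_int_factor C0.
have Dp := chart_dvd DE.
have [E Emin Econj] :=
  mobius_decomposition p_odd uU DE c0 r0 disc tE wU CE.
exists ((if delta then 1 else 2) * p ^ m.-1)%N, E; split=> //.
have e2 := ramified_index absKP uU DE sE s1 dimK eP e_gt1.
have -> : v_unif absK e (lambda ^+ p - eps) = (m.*2.+1)%:R.
  rewrite -(double_vp_cayley_pow absKP uU DE sE p_odd wU CE) e2 /v_unif /vp.
  by rewrite lambda_mu exprMn eps_p -{2}[eps]mulr1 -mulrBr abs_eps.
have m0 := coord_pow1_val_gt0 Dp wU CE.
have -> : ((m.*2.+1)%:R - 3%:R) / 2%:R = (m.-1)%:R :> R.
  rewrite -[in LHS](prednK m0) doubleS -natrB// !subSS subn0 -muln2 natrM.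
  by rewrite mulfK// pnatr_eq0.
rewrite powR_mulrn ?ler0n// natrM natrX; congr (_ * _).
by case: delta.
Qed.
End Core.

End RamifiedMobius.

Lemma mul_frac_cancel (F : fieldType) (x y v : F) : v != 0 ->
  x * v * (y / v) = x * y.
Proof. by move=> v0; field. Qed.

Section TranslationParameter.
Context (R : realType) (p : nat) (p_pr : prime p).
Context (K : fieldExtType (padic p_pr)) (absK : K -> R).
Hypothesis absKP : extends_padic_abs absK.
Local Notation Zp := (padic_int p_pr).
Local Notation Qp := (padic p_pr).
Local Notation "x %:F" := (@FracField.tofrac (padic_int p_pr) x : Qp).
Context (s : K) (D u : Zp) (t : Qp) (k : int).
Hypothesis uU : u \is a GRing.unit.
Hypothesis DE : D = p%:R * u.
Hypothesis sE : s ^+ 2 = (D%:F)%:A.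

Let absM := extends_padic_absM absKP.
Let p0 : 0 < p%:R :> R. Proof. by rewrite ltr0n prime_gt0. Qed.
Let p1 : 1 < p%:R :> R. Proof. by rewrite ltr1n prime_gt1. Qed.
Let r : Qp := p%:R ^ k.

Lemma absK_scaled_generator : absK (r%:A * s) ^+ 2 = p%:R ^ (- (2 * k + 1)).
Proof.
rewrite absM exprMn (absK_generator absKP uU DE sE).
have -> : absK r%:A = p%:R ^ (- k).
  by have := absK_padic absKP k (unitr1 _); rewrite tofrac_one mulr1.
rewrite exprnP exprz_exp -expfzDr; last exact: lt0r_neq0.
by congr (_ ^ _); lia.
Qed.

Lemma absK_scalar_neq : absK t%:A != absK (r%:A * s).
Proof.
apply/eqP => ts; have := scalar_sqr_abs_neq absKP t k.
by rewrite ts absK_scaled_generator eqxx.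
Qed.

Lemma absK_scaled_unit_sqr j (v : Zp) : v \is a GRing.unit ->
  absK (p%:R ^ j * v%:F)%:A ^+ 2 = p%:R ^ (- (2 * j)).
Proof.
move=> vU; rewrite absK_padic// exprnP exprz_exp; congr (_ ^ _); lia.
Qed.

(** For the valuations [j] of [t] and [k] of [r], [2 j < 2 k + 1] gives [j <= k]. *)
Lemma fixing_parameter : absK (r%:A * s) < absK t%:A ->
  exists B : Zp, t * B%:F = r.
Proof.
move=> st; have t0 : t != 0.
  apply: contraTneq st => ->.
  by rewrite scale0r absK_zero// -leNgt (extends_padic_abs_ge0 absKP).
have [j [v vU tE]] := padic_factor t0.
have : absK (r%:A * s) ^+ 2 < absK t%:A ^+ 2.
  by rewrite ltr_pXn2r// nnegrE (extends_padic_abs_ge0 absKP).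
rewrite absK_scaled_generator tE absK_scaled_unit_sqr// ltr_eXz2l// => jk.
have [i kE] : exists i : nat, k = j + i%:Z by exists (absz (k - j)%R); lia.
exists (p%:R ^+ i * v^-1).
rewrite -[v^-1]mul1r mulrA mulr1 (tofrac_div _ vU) tofracX_p /r kE.
rewrite expfzDr ?padic_p_neq0// -exprnP.
exact: mul_frac_cancel (padic_tofrac_neq0 vU).
Qed.

(** Now [2 k + 1 < 2 j] gives [j >= k + 1], and the extra p is absorbed by [D]. *)
Lemma swapping_parameter : absK t%:A < absK (r%:A * s) ->
  exists B : Zp, t = r * D%:F * B%:F.
Proof.
move=> st; have [->|t0] := eqVneq t 0.
  by exists 0; rewrite tofrac_zero mulr0.
have [j [v vU tE]] := padic_factor t0.
have : absK t%:A ^+ 2 < absK (r%:A * s) ^+ 2.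
  by rewrite ltr_pXn2r// nnegrE (extends_padic_abs_ge0 absKP).
rewrite absK_scaled_generator tE absK_scaled_unit_sqr// ltr_eXz2l// => jk.
have [i jE] : exists i : nat, j = k + 1 + i%:Z.
  by exists (absz (j - (k + 1))%R); lia.
exists (p%:R ^+ i * v / u).
have -> : r * D%:F * (p%:R ^+ i * v / u)%:F =
    r * (p%:R ^+ i.+1 * v : Zp)%:F.
  rewrite -mulrA -tofrac_mul DE; congr (_ * (_)%:F).
  by rewrite -[RHS]mulr1 -(mulrV uU) exprS; ring.
rewrite tofrac_mul tofracX_p mulrA; congr (_ * _).
rewrite /r jE -addrA expfzDr ?padic_p_neq0//; congr (_ * _).
Qed.
End TranslationParameter.

Theorem theorem5p4 (R : realType) (p : nat) (p_pr : prime p)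
    (p_ge3 : (3 <= p)%N)
    (a b c d : padic p_pr) (det_neq0 : a * d - b * c != 0)
    (* K = Q_p(sqrtD), a ramified quadratic extension of Q_p *)
    (K : fieldExtType (padic p_pr)) (sqrtD : K)
    (sqrtDE : sqrtD ^+ 2 = ((d - a) ^+ 2 + 4%:R * b * c)%:A)
    (sqrtD_notin : sqrtD \notin 1%VS)
    (K_gen : <<1%VS; sqrtD>>%VS = fullv)
    (absK : K -> R) (absKP : extends_padic_abs absK)
    (K_quadratic : \dim {:K} = 2%N)
    (e : nat) (eP : ramification_index absK e) (K_ramified : (1 < e)%N)
    (pi : K) (piP : uniformizer absK pi)
    (lambda : K)
    (lambdaE : lambda = ((a + d)%:A + sqrtD) / ((a + d)%:A - sqrtD))
    (lambda_not_root : forall n : nat, (0 < n)%N -> lambda ^+ n <> 1) :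
  absK (a + d)%:A != absK sqrtD /\
  (absK (a + d)%:A > absK sqrtD ->
    eq_mod absK pi lambda 1 /\
    exists (M : nat) (E : 'I_M -> set (padic_P1 p_pr)),
      [/\ M%:R = 2%:R * p%:R `^ ((v_unif absK e (lambda ^+ p - 1) - 3%:R) / 2%:R),
          minimal_decomposition (mobius a b c d) E &
          forall i, conjugate_to_adding_machine (mobius a b c d) (E i)
                      (fun s => (p ^ s)%N)]) /\
  (absK (a + d)%:A < absK sqrtD ->
    eq_mod absK pi lambda (- 1) /\
    exists (M : nat) (E : 'I_M -> set (padic_P1 p_pr)),
      [/\ M%:R = p%:R `^ ((v_unif absK e (lambda ^+ p + 1) - 3%:R) / 2%:R),
          minimal_decomposition (mobius a b c d) E &
          forall i, conjugate_to_adding_machine (mobius a b c d) (E i)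
                      (fun s => (2 * p ^ s)%N)]).
Proof.
have p_odd : odd p.
  by have [p2|//] := even_prime p_pr; rewrite p2 in p_ge3.
(* For [c = 0] the discriminant would be the square [(d - a)^2]. *)
have c0 : c != 0.
  apply/eqP => c0; apply: (@sqr_not_scalar _ _ _ sqrtD_notin (d - a)).
  by rewrite sqrtDE c0 mulr0 addr0.
have [k [u [uU disc]]] :=
  ramified_discriminant p_odd absKP K_quadratic eP K_ramified sqrtD_notin sqrtDE.
have r0 : p%:R ^ k != 0 :> padic p_pr := expfz_neq0 k (padic_p_neq0 p_pr).
have [s [sqrtD_s sE s1]] : exists s : K, [/\ sqrtD = (p%:R ^ k)%:A * s,
    s ^+ 2 = (FracField.tofrac (p%:R * u))%:A & s \notin 1%VS].
  by apply: scalar_rescale r0 sqrtD_notin _; rewrite sqrtDE disc.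
set D := p%:R * u in disc sE.
have lambdaE' : lambda = ((a + d)%:A + (p%:R ^ k)%:A * s) /
    ((a + d)%:A - (p%:R ^ k)%:A * s) by rewrite lambdaE sqrtD_s.
have decomposition B delta tE :=
  ramified_mobius_decomposition p_odd absKP K_quadratic eP K_ramified
    (B := B) (delta := delta) uU (erefl D) r0 c0 disc tE sE s1 lambdaE'
    lambda_not_root.
have lambda_mod B delta tE := lambda_sub_lt1 p_odd absKP
    (B := B) (delta := delta) uU (erefl D) r0 tE sE s1 lambdaE'.
rewrite sqrtD_s; split.
  exact: (absK_scalar_neq absKP (a + d) k uU (erefl D) sE).
split=> st.
  have [B BE] := fixing_parameter absKP uU (erefl D) sE st.
  split; first by apply/piP; exact: (lambda_mod B false BE).
  exact: (decomposition B false BE).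
have [B BE] := swapping_parameter absKP uU (erefl D) sE st.
split; first by apply/piP; exact: (lambda_mod B true BE).
have [M [E [ME Emin Econj]]] := decomposition B true BE.
by exists M, E; split=> //; rewrite ME mul1r opprK.
Qed.
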